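(* Let $G$ be a compact group, let $\phi\in\hat G\setminus\{\mathbf{1}\}$ be a non-trivial irreducible character, and let $\{\Sigma_n\curvearrowright X_n\}_{n=1}^\infty$ be an asymptotically oligomorphic sequence of transitive actions of finite groups on finite sets. Then for every word $w\in F_r$ which is not a proper power, the expectation under the $w$-measure of $\mathrm{Ind}_n\phi=\mathrm{Ind}_{X_n}\phi\in\widehat{G\wr_{X_n}\Sigma_n}$ has polynomial decay rate in its dimension: $$\mathbb{E}_w[\mathrm{Ind}_n\phi]=O\left(\dim(\mathrm{Ind}_n\phi)^{-1/2}\right).$$
   Context: A sequence of finite group actions $\{\Sigma_n\curvearrowright X_n\}_{n\ge1}$ is asymptotically oligomorphic if for every $t\in\mathbb{N}$ the number of orbits of the diagonal actions is bounded: $\sup_n|X_n^t/\Sigma_n|<\infty$. $F_r$ is the free group of rank $r$. A word $w$ is a proper power if $w=u^k$ for some $u\in F_r$ and $k\ge2$ (in particular $w=1$ is a proper power). For a compact group $K$ and a class function $f$ on $K$, $\mathbb{E}_w[f]=\mathbb{E}_\alpha[f(\alpha(w))]$, where $\alpha$ is a Haar-random homomorphism $F_r\to K$ (i.e. the images of the elements of a basis are independent Haar-random elements of $K$). $\hat G$ is the set of irreducible (continuous, finite-dimensional complex) characters of $G$ and $\mathbf{1}$ is the trivial one. For a finite group $\Sigma$ acting on a finite set $X$, $G\wr_X\Sigma=G^X\rtimes\Sigma$, with $\Sigma$ permuting coordinates; elements $(v,\sigma)$ are thought of as monomial $X\times X$ matrices with $(x,y)$ entry $v(x)$ if $\sigma(x)=y$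 and $0$ otherwise. The character $\mathrm{Ind}_X\phi$ of $G\wr_X\Sigma$ is $\mathrm{Ind}_X\phi(v,\sigma)=\sum_{x\in X:\sigma(x)=x}\phi(v(x))$; its dimension is $|X|\cdot\dim\phi$. The implied constant may depend on $w$, $G$, $\phi$ and the sequence of actions, but not on $n$. *)

(* Defs.v *)
From HB Require Import structures.
From mathcomp Require Import all_boot all_order all_algebra all_fingroup all_solvable.
From mathcomp Require Import complex.
From mathcomp Require Import all_classical all_reals all_analysis.

Set Implicit Arguments.
Unset Strict Implicit.
Unset Printing Implicit Defensive.

Import Order.TTheory GRing.Theory Num.Theory.
Import numFieldTopology.Exports numFieldNormedType.Exports.

Local Open Scope classical_set_scope.
Local Open Scope ring_scope.
Local Open Scope group_scope.

(* The letter [(x, true)] is the generator [x], [(x, false)] its inverse. *)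
Section FreeGroup.
Variable T : choiceType.
Implicit Types (a b : T * bool) (s t u : seq (T * bool)).

Definition flip a : T * bool := (a.1, ~~ a.2).

Definition reduced s : bool := sorted (fun a b => b != flip a) s.

Record freegroup : Type := FreeGroup { word :> seq (T * bool); _ : reduced word }.

HB.instance Definition _ := [isSub for word].
HB.instance Definition _ := [Choice of freegroup by <:].

Lemma flipK : involutive flip.
Proof. by case=> x b; rewrite /flip /= negbK. Qed.

Definition push a s :=
  if s is b :: s' then if b == flip a then s' else a :: s else [:: a].

(* Free reduction of the concatenation of [s] with a reduced word [t]. *)
Definition reduce_cat s t := foldr push t s.

Lemma reduced_behead a s : reduced (a :: s) -> reduced s.
Proof. exact: path_sorted. Qed.

Lemma push_reduced a s : reduced s -> reduced (push a s).
Proof.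
case: s => [|b s] //= rs; case: eqP => [_|/eqP ba]; first exact: path_sorted rs.
by rewrite /= ba.
Qed.

Lemma reduce_cat_reduced s t : reduced t -> reduced (reduce_cat s t).
Proof. by move=> rt; elim: s => //= a s; apply: push_reduced. Qed.

Lemma push_flipK a s : reduced s -> push (flip a) (push a s) = s.
Proof.
case: s => [_|b s rs] /=; first by rewrite flipK eqxx.
case: eqP => [ba|_]; last by rewrite /= flipK eqxx.
case: s rs => [|c s] /=; first by rewrite ba.
by move=> /andP[cb _]; rewrite -ba (negPf cb).
Qed.

Lemma push_flipKV a s : reduced s -> push a (push (flip a) s) = s.
Proof. by move=> rs; rewrite -{1}(flipK a) push_flipK. Qed.

Lemma reduce_cat_push a s t :
  reduced t -> reduce_cat (push a s) t = push a (reduce_cat s t).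
Proof.
move=> rt; case: s => //= b s; case: eqP => [->|//].
by rewrite push_flipKV // reduce_cat_reduced.
Qed.

Lemma reduce_catA s t u : reduced u ->
  reduce_cat (reduce_cat s t) u = reduce_cat s (reduce_cat t u).
Proof. by move=> ru; elim: s => //= a s IHs; rewrite reduce_cat_push ?IHs. Qed.

Lemma reduce_cats0 s : reduced s -> reduce_cat s [::] = s.
Proof.
elim: s => //= a s IHs rs; rewrite IHs; last exact: path_sorted rs.
by case: s rs {IHs} => //= b s /andP[/negPf->].
Qed.

Definition inv_word s := rev (map flip s).

Lemma inv_wordK : involutive inv_word.
Proof. by move=> s; rewrite /inv_word map_rev revK (mapK flipK). Qed.

Lemma inv_word_reduced s : reduced s -> reduced (inv_word s).
Proof.
rewrite /reduced /inv_word rev_sorted sorted_map.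
apply: sub_sorted => a b /= ba; apply: contra ba => /eqP.
by rewrite flipK => /eqP; rewrite eq_sym -(inj_eq (can_inj flipK)) flipK.
Qed.

Lemma reduce_cat_invl s t : reduced t ->
  reduce_cat (inv_word s) (reduce_cat s t) = t.
Proof.
move=> rt; elim: s => //= a s IHs.
rewrite /inv_word /= rev_cons /reduce_cat foldr_rcons push_flipK //.
exact: reduce_cat_reduced.
Qed.

Definition freegroup1 : freegroup := @FreeGroup [::] isT.
Definition freegroup_mul (s t : freegroup) : freegroup :=
  FreeGroup (reduce_cat_reduced s (valP t)).
Definition freegroup_inv (s : freegroup) : freegroup :=
  FreeGroup (inv_word_reduced (valP s)).

Lemma freegroup_mulA : associative freegroup_mul.
Proof. by move=> s t u; apply: val_inj; rewrite /= reduce_catA // (valP u). Qed.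

Lemma freegroup_mul1 : left_id freegroup1 freegroup_mul.
Proof. by move=> s; apply: val_inj. Qed.

Lemma freegroup_1mul : right_id freegroup1 freegroup_mul.
Proof. by move=> s; apply: val_inj; rewrite /= reduce_cats0 // (valP s). Qed.

Lemma freegroup_mulV : left_inverse freegroup1 freegroup_inv freegroup_mul.
Proof.
move=> s; apply: val_inj => /=.
by rewrite -{2}(reduce_cats0 (valP s)) reduce_cat_invl.
Qed.

Lemma freegroup_Vmul : right_inverse freegroup1 freegroup_inv freegroup_mul.
Proof.
move=> s; apply: val_inj => /=.
rewrite -{1}(inv_wordK s).
by rewrite -{2}(reduce_cats0 (inv_word_reduced (valP s))) reduce_cat_invl.
Qed.

HB.instance Definition _ := isGroup.Build freegroup
  freegroup_mulA freegroup_mul1 freegroup_1mul freegroup_mulV freegroup_Vmul.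

Definition freegroup_gen (x : T) : freegroup := @FreeGroup [:: (x, true)] isT.

End FreeGroup.

(* With [u = 1] and [k = 2], the trivial word is a proper power. *)
Definition proper_power (F : groupType) (w : F) : Prop :=
  exists (u : F) (k : nat), (2 <= k)%N /\ w = u ^+ k.

HB.mixin Record Group_isTopological G & monoid.Group G & Topological G := {
  mulg_continuous : continuous (fun p : G * G => p.1 * p.2);
  invg_continuous : continuous (fun x : G => x^-1)
}.

(* The point is there only because measurable types are pointed. *)
#[short(type="topologicalGroupType")]
HB.structure Definition TopologicalGroup :=
  { G of monoid.Group G & PointedTopological G & Group_isTopological G }.

Notation borel K := (g_sigma_algebraType (@open K)).

(* Outer regularity is part of the definition: a compact group need not be
   second countable, and then not every Borel measure is regular. *)
Definition haar_probability (R : realType) (K : topologicalGroupType)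
    (mu : probability (borel K) R) : Prop :=
  (forall (g : K) (A : set (borel K)), measurable A ->
     mu [set g * x | x in A] = mu A) /\
  (forall A : set (borel K), measurable A ->
     mu A = ereal_inf [set mu U | U in [set U : set K | open U /\ A `<=` U]]).

(* The marginals are Borel, but their joint law lives on the product
   sigma-algebra of [K^r], which can be smaller than the Borel one. This is
   enough to integrate continuous functions of the images of the basis. *)
Definition haar_random_hom (R : realType) (r : nat) (K : topologicalGroupType)
    (d : measure_display) (Omega : measurableType d) (P : probability Omega R)
    (alpha : Omega -> freegroup 'I_r -> K) : Prop :=
  let X (i : 'I_r) (om : Omega) : borel K := alpha om (freegroup_gen i) in
  [/\ forall om, monoid.monoid_morphism (alpha om),
      forall i, measurable_fun [set: Omega] (X i),
      exists2 mu : probability (borel K) R, haar_probability mu &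
        forall i (A : set (borel K)), measurable A -> P (X i @^-1` A) = mu A &
      forall A : 'I_r -> set (borel K), (forall i, measurable (A i)) ->
        P (\bigcap_i (X i @^-1` A i)) = (\prod_(i < r) P (X i @^-1` A i))%E].

Definition complex_expectation (R : realType) (d : measure_display)
    (Omega : measurableType d) (P : probability Omega R) (f : Omega -> R[i]) :
    R[i] :=
  Complex (\int[P]_om complex.Re (f om))%R (\int[P]_om complex.Im (f om))%R.

Definition word_expectation (R : realType) (r : nat) (K : topologicalGroupType)
    (d : measure_display) (Omega : measurableType d) (P : probability Omega R)
    (alpha : Omega -> freegroup 'I_r -> K) (w : freegroup 'I_r) (f : K -> R[i]) :
    R[i] :=
  complex_expectation P (fun om => f (alpha om w)).

(* As in MathComp, matrices act on row vectors and subspaces are row spaces. *)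
Definition continuous_repr (R : realType) (K : topologicalGroupType) (d : nat)
    (rho : K -> 'M[R[i]]_d) : Prop :=
  [/\ rho 1 = (1%:M)%R,
      forall g h, rho (g * h) = (rho g *m rho h)%R &
      continuous (rho : K -> 'M[(R[i])^o]_d)].

Definition irreducible_repr (R : realType) (K : topologicalGroupType) (d : nat)
    (rho : K -> 'M[R[i]]_d) : Prop :=
  (0 < d)%N /\
  forall U : 'M[R[i]]_d, (forall g, stablemx U (rho g)) ->
    (U != 0)%R -> row_full U.

Definition irreducible_character (R : realType) (K : topologicalGroupType)
    (d : nat) (chi : K -> R[i]) : Prop :=
  exists rho : K -> 'M[R[i]]_d,
    [/\ continuous_repr rho, irreducible_repr rho &
        forall g, chi g = (\tr (rho g))%R].

(* [G^X x S] with the product topology. In the monomial matrix of [(v, s)] the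
   entry [v x] sits at [(x, x s)], so that with MathComp's right actions matrix
   multiplication is [(v, s) * (v', s') = (x |-> v x * v' (x s), s * s')]. *)
Definition wreath (G : topologicalGroupType) (S : finGroupType) (X : finType)
    (to : {action S &-> X}) : Type :=
  ({ptws X -> G} * discrete_topology S)%type.

Section Wreath.
Variables (G : topologicalGroupType) (S : finGroupType) (X : finType).
Variable to : {action S &-> X}.
Implicit Types g h k : wreath G to.

HB.instance Definition _ := Topological.on (wreath G to).

Definition wreath1 : wreath G to := (fun=> 1, 1).
Definition wreath_mul g h : wreath G to :=
  (fun x => g.1 x * h.1 (to x g.2), (g.2 : S) * h.2).
Definition wreath_inv g : wreath G to :=
  (fun x => (g.1 (to x (g.2 : S)^-1))^-1, (g.2 : S)^-1).

Lemma wreath_mulA : associative wreath_mul.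
Proof.
move=> g h k; congr pair; last by rewrite /= mulgA.
by apply/funext => x /=; rewrite actM mulgA.
Qed.

Lemma wreath_mul1 : left_id wreath1 wreath_mul.
Proof.
case=> v s; congr pair; last by rewrite /= mul1g.
by apply/funext => x /=; rewrite act1 mul1g.
Qed.

Lemma wreath_1mul : right_id wreath1 wreath_mul.
Proof.
case=> v s; congr pair; last by rewrite /= mulg1.
by apply/funext => x /=; rewrite mulg1.
Qed.

Lemma wreath_mulV : left_inverse wreath1 wreath_inv wreath_mul.
Proof.
move=> g; congr pair; last by rewrite /= mulVg.
by apply/funext => x /=; rewrite mulVg.
Qed.

Lemma wreath_Vmul : right_inverse wreath1 wreath_inv wreath_mul.
Proof.
move=> g; congr pair; last by rewrite /= mulgV.
by apply/funext => x /=; rewrite -actM mulgV act1 mulgV.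
Qed.

HB.instance Definition _ := isPointed.Build (wreath G to) wreath1.
HB.instance Definition _ := isGroup.Build (wreath G to)
  wreath_mulA wreath_mul1 wreath_1mul wreath_mulV wreath_Vmul.

Lemma wreath_mulE g h : g * h = wreath_mul g h. Proof. by []. Qed.

Lemma wreath_invE g : g^-1 = wreath_inv g. Proof. by []. Qed.

Lemma wreath_cvg (I : Type) (F : set_system I) (f : I -> wreath G to) g :
  Filter F ->
  (forall x, (fun i => (f i).1 x : G) @ F --> (g.1 x : G)) ->
  (\forall i \near F, (f i).2 = g.2) -> f @ F --> g.
Proof.
move=> FF cv1 cv2 U [[A B] /= [nA nB] AB].
have : (fun i => (f i).1) @ F --> (g.1 : {ptws X -> G}).
  apply/cvg_sup => x V.
  rewrite (@nbhsE (initial_topology (fun v : X -> G => v x))).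
  move=> [_ [[C oC <-] Cg] CV].
  have FC : nbhs (g.1 x : G) C by apply: open_nbhs_nbhs.
  apply: (@filterS _ F FF _ _ _ (cv1 x _ FC)) => i Ci; exact: CV.
move=> /(_ _ nA) FA; apply: (@filterS2 _ F FF _ _ _ _ FA cv2) => i Ai fi.
by apply: AB; split => //=; rewrite fi; exact: nbhs_singleton nB.
Qed.

Lemma wreath_fst_continuous x : continuous (fun g : wreath G to => g.1 x : G).
Proof.
move=> g; apply: (@continuous_comp _ _ _ fst (fun v : {ptws X -> G} => v x)).
  exact: cvg_fst.
exact: (@proj_continuous X (fun=> G) x).
Qed.

Lemma wreath_snd_near g : \forall h \near g, h.2 = g.2.
Proof.
exists (setT, [set g.2]) => /=; first by split; [exact: filterT|].
by move=> [v s] [].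
Qed.

Lemma wreath_mul_continuous :
  continuous (fun p : wreath G to * wreath G to => p.1 * p.2).
Proof.
move=> [g h].
have near1 : \forall p \near (g, h), p.1.2 = g.2.
  exact: (@cvg_fst _ _ (nbhs g) (nbhs h) _ _ (wreath_snd_near g)).
have near2 : \forall p \near (g, h), p.2.2 = h.2.
  exact: (@cvg_snd _ _ (nbhs g) (nbhs h) _ _ (wreath_snd_near h)).
apply: wreath_cvg => [x /=|]; last first.
  have E (p : wreath G to * wreath G to) :
    p.1.2 = g.2 -> p.2.2 = h.2 -> (p.1 * p.2).2 = (g * h).2.
    by case: p => -[v s] [v' s'] /= -> ->.
  by near=> p; apply: E; near: p.
have cv1 : (fun p : wreath G to * wreath G to => p.1.1 x : G) @ (g, h)
    --> (g.1 x : G).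
  apply: (@cvg_comp _ _ _ fst (fun k : wreath G to => k.1 x : G)).
    exact: cvg_fst.
  exact: wreath_fst_continuous.
have cv2 : (fun p : wreath G to * wreath G to => p.2.1 (to x p.1.2) : G) @ (g, h)
    --> (h.1 (to x g.2) : G).
  have cv : (fun p : wreath G to * wreath G to => p.2.1 (to x g.2) : G) @ (g, h)
      --> (h.1 (to x g.2) : G).
    apply: (@cvg_comp _ _ _ snd (fun k : wreath G to => k.1 (to x g.2) : G)).
      exact: cvg_snd.
    exact: wreath_fst_continuous.
  apply: cvg_trans cv; apply: near_eq_cvg.
  have E (p : wreath G to * wreath G to) :
    p.1.2 = g.2 -> p.2.1 (to x g.2) = p.2.1 (to x p.1.2) by move=> ->.
  by near=> p; apply: E; near: p.
exact: (cvg_comp2 cv1 cv2 (@mulg_continuous G (g.1 x, h.1 (to x g.2)))).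
Unshelve. all: by end_near. Qed.

Lemma wreath_inv_continuous : continuous (fun g : wreath G to => g^-1).
Proof.
move=> g; apply: (@wreath_cvg _ (nbhs g) wreath_inv (wreath_inv g)) => [x|].
  pose y := to x (g.2 : S)^-1.
  have cv : (fun h : wreath G to => (h.1 y)^-1 : G) @ g --> ((g.1 y)^-1 : G).
    apply: (@cvg_comp _ _ _ (fun h : wreath G to => h.1 y : G)).
      exact: wreath_fst_continuous.
    exact: invg_continuous.
  apply: cvg_trans cv; apply: near_eq_cvg.
  have E (h : wreath G to) :
    h.2 = g.2 -> (h.1 y)^-1 = (h.1 (to x (h.2 : S)^-1))^-1 by move=> ->.
  by near=> h; apply: E; near: h; exact: wreath_snd_near.
have E (h : wreath G to) : h.2 = g.2 -> (wreath_inv h).2 = (wreath_inv g).2.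
  by case: h => v s /= ->.
by near=> h; apply: E; near: h; exact: wreath_snd_near.
Unshelve. all: by end_near. Qed.

HB.instance Definition _ := Group_isTopological.Build (wreath G to)
  wreath_mul_continuous wreath_inv_continuous.

Lemma wreath_compact : compact [set: G] -> compact [set: wreath G to].
Proof.
move=> cG.
have cX : compact [set: {ptws X -> G}].
  have := @tychonoff X (fun=> G) (fun=> setT) (fun=> cG).
  by congr (compact _); apply/seteqP; split.
have cS : compact [set: discrete_topology S].
  exact/finite_compact/(@finite_finset S).
have := compact_setX cX cS.
by congr (compact _); apply/seteqP; split.
Qed.

Lemma wreath_hausdorff : hausdorff_space G -> hausdorff_space (wreath G to).
Proof.
move=> hG g h gh; have eq2 : g.2 = h.2.
  have [k [/= <- ->]] // := gh _ _ (wreath_snd_near g) (wreath_snd_near h).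
have eq1 x : g.1 x = h.1 x.
  apply: hG => A B nA nB.
  have [k [kA kB]] :=
    gh _ _ (wreath_fst_continuous nA) (wreath_fst_continuous nB).
  by exists (k.1 x).
by case: g h eq1 eq2 {gh} => v s [v' s'] /= /funext -> ->.
Qed.
End Wreath.

Definition induced_char (R : realType) (G : topologicalGroupType) (S : finGroupType)
    (X : finType) (to : {action S &-> X}) (phi : G -> R[i]) :
    wreath G to -> R[i] :=
  fun g => (\sum_(x : X | to x g.2 == x) phi (g.1 x))%R.

Definition asymptotically_oligomorphic (S : nat -> finGroupType)
    (X : nat -> finType) (to : forall n, {action S n &-> X n}) : Prop :=
  forall t : nat, exists B : nat, forall n,
    (#|orbit (to n * t)%act [set: S n]%SET @: [set: t.-tuple (X n)]%SET| <= B)%N.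

(* Main.v *)
Require Import Defs.
From HB Require Import structures.
From mathcomp Require Import all_boot all_order all_algebra all_fingroup all_solvable.
From mathcomp Require Import complex.
From mathcomp Require Import all_classical all_reals all_analysis.
From mathcomp Require Import measurable_realfun.

Set Implicit Arguments.
Unset Strict Implicit.
Unset Printing Implicit Defensive.

Import Order.TTheory GRing.Theory Num.Theory.
Import numFieldTopology.Exports numFieldNormedType.Exports.

Local Open Scope classical_set_scope.
Local Open Scope ring_scope.

(** Up to conjugation [w] is a cyclically reduced word [c] of some length [l]
that is not periodic. Multiplying out the monomial matrices of the letters
([induced_char_paths]) writes the value of the induced character at [w] as a sum
over the maps [x] from the cyclic positions of [c] to [X n]: the letter at each
position has to send the point at its source to the point at its target, and
the summand is then [phi] of the product of the matrix entries read along the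
closed path [x].

If [x] is injective, the entry read by the first letter is read only once.
Translating that entry by [h] multiplies the product, up to a cyclic rotation, by
[h] or its inverse on one side and changes nothing else, so the expectation of
the matrix of the product is fixed by the representation; it vanishes because
the representation is irreducible and not trivial
([injective_path_expectation]).

On the other paths [phi] is bounded, and it remains to show that the
probabilities that the random permutations follow them have a sum of order
[#|X n|^-1] ([sum_noninjective_movers]). The permutations that move the sources
of a letter along [x] as prescribed form a coset of the pointwise stabilizer of
these sources, and the index of a pointwise stabilizer is a product of orbit
sizes: each point contributes its orbit under the stabilizer of the points
taken before it ([card_stab_chain]). Everything depends on the order in which
the points are taken. Choose a linear order of the positions that every letter
respects, that is, a stacking of the word in the sense of Louder and Wilton. If
[f j] is the size of the orbit of [x j] under the stabilizer of the points at
larger positions, then the edge between two consecutive positions contributes at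
least the larger of the two values of [f] ([vertex_le_src], [vertex_le_tgt]).
By transitivity [f] is [#|X n|] at the largest position, and it is [1] at the
lower of two positions with the same point; so, going around the cycle, the
product over the edges exceeds the product over the positions by a factor
[#|X n|] ([cyclic_max_prod]). Hence a non-injective tuple [x] contributes at most
the inverse of the product of [#|X n|] and the size of its orbit. The inverses of
the orbit sizes add up to the number of orbits of [S n] on [l]-tuples, which is
bounded.

A stacking is obtained by refining a preorder ([exists_stacking]). Positions
that are not separated yet are identified, which gives a quotient graph of the
cycle. If it has more edges than vertices, some cochain is not a coboundary and
has sum zero along the word; its partial sums are heights that separate further
positions. Otherwise every vertex has degree two, and a coincidence of two
positions makes the word periodic, or else equal to a rotation of its own
inverse, which is impossible for a reduced word.

For the irreducibility of the induced character, a nonzero vector of a stable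
subspace has a component that is moved by some element of [G], and the
displacement lies in a single summand; this summand, and by transitivity all the
others, are then contained in the subspace ([induced_irreducible]). *)

(** * Cochains that are not coboundaries *)

(** The cochain is sought among those orthogonal to all coboundaries. The
equations for this, one at each vertex, add up to zero, so that one of them can
be traded for the condition on [m]; there are then fewer equations than edges. *)
Lemma exists_noncoboundary (V E : finType) (s t : E -> V) (m : E -> rat) :
  (#|V| < #|E|)%N ->
  exists2 c : E -> rat, \sum_e m e * c e = 0 &
    forall theta : V -> rat, ~ forall e, c e = theta (t e) - theta (s e).
Proof.
move=> VE.
have /card_gt0P[e0 _] := leq_ltn_trans (leq0n _) VE.
pose v0 := s e0.
pose inc (v : V) e : rat := (v == t e)%:R - (v == s e)%:R.
(* The column of [v0] expresses the condition on [m]: the equation at [v0]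
follows from those at the other vertices. *)
pose M : 'M[rat]_(#|E|, #|V|) := \matrix_(a, b)
  if enum_val b == v0 then m (enum_val a) else inc (enum_val b) (enum_val a).
have : kermx M != 0.
  rewrite -mxrank_eq0 mxrank_ker subn_eq0 -ltnNge.
  exact: leq_ltn_trans (rank_leq_col M) VE.
case/rowV0Pn => u /sub_kermxP uM u0.
pose c (e : E) : rat := u 0 (enum_rank e).
have sumE (F : E -> rat) : \sum_e c e * F e = \sum_(a < #|E|) u 0 a * F (enum_val a).
  rewrite [RHS](reindex (@enum_rank E)) /=; last exact/onW_bij/enum_rank_bij.
  by apply: eq_bigr => e _; rewrite enum_rankK.
have cm : \sum_e c e * m e = 0.
  have := congr1 (fun A : 'rV_#|V| => A 0 (enum_rank v0)) uM.
  rewrite !mxE sumE => uM0; apply: etrans uM0; apply: eq_bigr => a _.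
  by rewrite mxE enum_rankK eqxx.
have cv v : \sum_e c e * inc v e = 0.
  have cv1 z : z != v0 -> \sum_e c e * inc z e = 0.
    move=> zv0; have := congr1 (fun A : 'rV_#|V| => A 0 (enum_rank z)) uM.
    rewrite !mxE sumE => uM0; apply: etrans uM0; apply: eq_bigr => a _.
    by rewrite mxE enum_rankK (negPf zv0).
  have [->|] := eqVneq v v0; last exact: cv1.
  have sum1 y : \sum_(z : V) (z == y)%:R = 1 :> rat.
    by rewrite (bigD1 y) //= eqxx big1 ?addr0 // => z /negPf ->.
  have : \sum_(z : V) \sum_e c e * inc z e = 0.
    rewrite exchange_big big1 //= => e _.
    by rewrite -mulr_sumr sumrB !sum1 subrr mulr0.
  by rewrite (bigD1 v0) //= [X in _ + X]big1 ?addr0.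
exists c; first by rewrite -[RHS]cm; apply: eq_bigr => e _; rewrite mulrC.
move=> theta ctheta.
have /eqP : \sum_e c e ^+ 2 = 0.
  transitivity (\sum_(v : V) theta v * \sum_e c e * inc v e); last first.
    by rewrite big1 // => v _; rewrite cv mulr0.
  under [RHS]eq_bigr do rewrite mulr_sumr.
  rewrite exchange_big /=; apply: eq_bigr => e _.
  rewrite expr2 [X in X * _]ctheta mulrC.
  under eq_bigr do rewrite mulrCA.
  rewrite -mulr_sumr; congr (_ * _).
  have pick y : \sum_(z : V) theta z * (z == y)%:R = theta y.
    rewrite (bigD1 y) //= eqxx mulr1 big1 ?addr0 // => z /negPf ->.
    by rewrite mulr0.
  by under eq_bigr do rewrite mulrBr; rewrite sumrB !pick.
rewrite psumr_eq0 => [/allP c0|e _]; last exact: sqr_ge0.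
case/negP: u0; apply/eqP/rowP => a; rewrite mxE.
have := c0 (enum_val a) (mem_index_enum _).
by rewrite sqrf_eq0 /c enum_valK => /eqP.
Qed.

(** Since ranks take at most [l] values, a preorder given by ranks can be refined
only finitely often, whatever the keys were. *)
Lemma exists_rank d (T : orderType d) (l : nat) (key : 'I_l -> T) :
  exists rho : 'I_l -> 'I_l, forall j k, (rho j < rho k)%N = (key j < key k)%O.
Proof.
pose below j := [set k | (key k < key j)%O]%SET.
have below_lt j : (#|below j| < l)%N.
  rewrite -[X in (_ < X)%N]card_ord -cardsT; apply: proper_card.
  by apply/properP; split; [exact: finset.subsetT|exists j; rewrite !inE // ltxx].
exists (fun j => Ordinal (below_lt j)) => j k /=.
have [jk|kj] := ltP (key j) (key k).
  apply: proper_card; apply/properP; split.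
    by apply/fintype.subsetP => i; rewrite !inE => /lt_trans; apply.
  by exists j; rewrite !inE ?jk ?ltxx.
apply/negbTE; rewrite -leqNgt; apply: subset_leq_card; apply/fintype.subsetP => i.
by rewrite !inE => /lt_le_trans; apply.
Qed.

(** * Stackings of cyclic words *)

Lemma val_iter_ordS l p (j : 'I_l) : iter p (@ordS l) j = ((j + p) %% l)%N :> nat.
Proof.
elim: p => [|p IH] /=; first by rewrite addn0 modn_small.
by rewrite IH -addn1 modnDml addn1 addnS.
Qed.

(** Partial sums; they close up around the cycle because the total is zero. *)
Lemma exists_height l (step : 'I_l -> rat) : \sum_j step j = 0 ->
  exists eta : 'I_l -> rat, forall j, eta (ordS j) = eta j + step j.
Proof.
move=> tot; exists (fun j => \sum_(k < l | (k < j)%N) step k) => j.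
have ltS : \sum_(k < l | (k < j.+1)%N) step k =
    \sum_(k < l | (k < j)%N) step k + step j.
  rewrite (bigD1 j) //= addrC; congr (_ + _); apply: eq_bigl => k.
  by rewrite ltnS [(k < j)%N]ltn_neqAle andbC.
rewrite -ltS; have [jl|jl] := ltnP j.+1 l.
  by apply: eq_bigl => k; rewrite /= modn_small.
have jE : j.+1 = l by apply/eqP; rewrite eqn_leq jl ltn_ord.
rewrite /= jE modnn big_pred0 // -[LHS]tot; apply: eq_bigl => k.
by rewrite ltn_ord.
Qed.

Section CyclicWord.
Variables (T : choiceType) (l : nat) (c : 'I_l -> T * bool).

(** The positions of a cyclic word are the vertices of a cycle, and [c j] labels
the edge between [j] and the next position. Edges are oriented along the
generators, so an inverse letter traverses its edge backwards. *)
Definition edge_src j := if (c j).2 then j else ordS j.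
Definition edge_tgt j := if (c j).2 then ordS j else j.

Definition cyclically_reduced := forall j, c (ordS j) != flip (c j).

Definition aperiodic := forall j k,
  (forall p, c (iter p (@ordS l) j) = c (iter p (@ordS l) k)) -> j = k.

(** When [rho] is injective this is a stacking of the word. In general the values
of [rho] are the vertices of a quotient of the cycle, in which two edges with the
same letter coincide as soon as they have the same source. *)
Definition order_preserving (rho : 'I_l -> 'I_l) := forall j k,
  (c j).1 = (c k).1 ->
  (rho (edge_src j) < rho (edge_src k))%N = (rho (edge_tgt j) < rho (edge_tgt k))%N.
End CyclicWord.

Section Stacking.
Variables (T : finType) (l : nat) (c : 'I_l -> T * bool).

Section Refinement.
Variable rho : 'I_l -> 'I_l.
Hypothesis rho_op : order_preserving c rho.

Let vertices := [set rho j | j : 'I_l]%SET.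

Lemma rho_edge_eq j k : (c j).1 = (c k).1 ->
  (rho (edge_src c j) == rho (edge_src c k)) = (rho (edge_tgt c j) == rho (edge_tgt c k)).
Proof.
move=> jk; have E (a b : 'I_l) : (a == b) = ~~ (a < b)%N && ~~ (b < a)%N.
  by rewrite -val_eqE /=; case: ltngtP.
by rewrite !E (rho_op jk) (rho_op (esym jk)).
Qed.

(** Every letter shifts heights by an amount that depends only on the edge of the
quotient graph, so comparing by [rho] first and by height next is compatible with
the letters. *)
Lemma exists_lex_refinement (eta : 'I_l -> rat) (diff : T * 'I_l -> rat) j k :
  (forall i, eta (edge_tgt c i) =
     eta (edge_src c i) + diff ((c i).1, rho (edge_src c i))) ->
  rho j = rho k -> eta j != eta k ->
  exists2 rho' : 'I_l -> 'I_l, order_preserving c rho' &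
    (#|vertices| < #|[set rho' j | j : 'I_l]%SET|)%N.
Proof.
move=> etaE rho_jk eta_jk.
pose key i : 'I_l *l rat := (rho i, eta i).
have [rho' rho'P] := exists_rank key.
have key_lt i1 i2 : (key i1 < key i2)%O =
    (rho i1 < rho i2)%N || (rho i1 == rho i2) && (eta i1 < eta i2).
  rewrite ltEprodlexi /= !leEord -[rho i1 == _]val_eqE /=.
  by case: ltngtP.
exists rho' => [i1 i2 i12|].
  rewrite !rho'P !key_lt rho_op // rho_edge_eq //.
  have [tE|//] := eqVneq (rho (edge_tgt c i1)); congr (_ || _) => /=.
  have /eqP sE : rho (edge_src c i1) == rho (edge_src c i2) by rewrite rho_edge_eq ?tE.
  by rewrite !etaE i12 sE ltrD2r.
pose h v := if [pick i | rho' i == v] is Some i then rho i else v.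
have rho'_eq i1 i2 : rho' i1 = rho' i2 -> key i1 = key i2.
  move=> e; apply/le_anti/andP; split; rewrite leNgt -rho'P e ltnn //.
have hE i : h (rho' i) = rho i.
  rewrite /h; case: pickP => [i' /eqP /rho'_eq[]|/(_ i)] //.
  by rewrite eqxx.
have -> : vertices = (h @: [set rho' j | j : 'I_l])%SET.
  apply/finset.setP => v; apply/imsetP/imsetP => [[i _ ->]|[i ii ->]].
    by exists (rho' i); [exact: imset_f|rewrite hE].
  by case/imsetP: ii => i' _ ->; exists i'.
rewrite ltn_neqAle leq_imset_card andbT; apply/imset_injP => hinj.
case/eqP: eta_jk; have [] : key j = key k by
  apply/rho'_eq/hinj; rewrite ?imset_f ?hE.
by [].
Qed.

(** The edge of the quotient graph traversed at position [j]. *)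
Let kappa j := ((c j).1, rho (edge_src c j)).
Let edges := [set kappa j | j : 'I_l]%SET.
(** All positions representing an edge give the same target ([tgt_kappa]). *)
Let tgt (e : T * 'I_l) :=
  if [pick j | kappa j == e] is Some j then rho (edge_tgt c j) else e.2.

Lemma tgt_kappa j : tgt (kappa j) = rho (edge_tgt c j).
Proof.
rewrite /tgt; case: pickP => [i|/(_ j)]; last by rewrite eqxx.
by case/eqP => ic /eqP; rewrite rho_edge_eq // => /eqP.
Qed.

(** A cochain with sum zero along the word integrates to heights on the
positions. If positions over the same vertex always had the same height, the
heights would define a potential on the vertices. *)
Lemma exists_separating_height : (#|vertices| < #|edges|)%N ->
  exists eta : 'I_l -> rat, exists diff : T * 'I_l -> rat,
    (forall i, eta (edge_tgt c i) = eta (edge_src c i) + diff (kappa i)) /\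
    exists j, exists2 k, rho j = rho k & eta j != eta k.
Proof.
move=> VE.
have inV j : rho j \in vertices by exact: imset_f.
have inE j : kappa j \in edges by exact: imset_f.
have srcV (e : {e | e \in edges}) : (val e).2 \in vertices.
  by have /imsetP[j _ ->] := valP e; exact: (inV (edge_src c j)).
have tgtV (e : {e | e \in edges}) : tgt (val e) \in vertices.
  by have /imsetP[j _ ->] := valP e; rewrite tgt_kappa inV.
pose s e : {v | v \in vertices} := exist _ (val e).2 (srcV e).
pose t e : {v | v \in vertices} := exist _ (tgt (val e)) (tgtV e).
pose ke j : {e | e \in edges} := exist _ (kappa j) (inE j).
pose sgn j : rat := if (c j).2 then 1 else -1.
have /(exists_noncoboundary s t (fun e => \sum_(j | ke j == e) sgn j)) :
    (#|{: {v | v \in vertices}}| < #|{: {e | e \in edges}}|)%N.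
  by rewrite !card_sig.
move=> [f f0 fN].
have /exists_height[eta etaE] : \sum_j sgn j * f (ke j) = 0.
  rewrite -[RHS]f0 (partition_big ke predT) //=; apply: eq_bigr => e _.
  by rewrite mulr_suml; apply: eq_bigr => j /eqP ->.
pose diff (x : T * 'I_l) := if insub x is Some e then f e else 0.
have diffE j : diff (kappa j) = f (ke j).
  by rewrite /diff (insubT (fun e => e \in edges) (inE j)).
exists eta, diff; split=> [i|].
  rewrite diffE /edge_tgt /edge_src; have := etaE i; rewrite /sgn.
  case: (c i).2 => ->; first by rewrite mul1r.
  by rewrite mulN1r subrK.
apply: contrapT => neta.
have eta_rho j k : rho j = rho k -> eta j = eta k.
  move=> jk; apply/eqP; apply: contrapT => /negP eta_jk.
  by apply: neta; exists j, k.
pose theta (v : {v | v \in vertices}) :=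
  if [pick j | rho j == val v] is Some j then eta j else 0.
have thetaE j v : val v = rho j -> theta v = eta j.
  rewrite /theta => ->; case: pickP => [i /eqP|/(_ j)]; last by rewrite eqxx.
  exact: eta_rho.
apply: (fN theta) => e.
have [j ->] : exists j, e = ke j.
  by have /imsetP[j _ ej] := valP e; exists j; exact: val_inj.
rewrite (thetaE (edge_tgt c j)) ?(thetaE (edge_src c j)) //=; last exact: tgt_kappa.
have := etaE j; rewrite /sgn /edge_tgt /edge_src; case: (c j).2 => ->.
  by rewrite mul1r addrC addKr.
by rewrite mulN1r opprB addrC subrK.
Qed.

Hypotheses (c_red : cyclically_reduced c) (c_aper : aperiodic c).

(** A half-edge is an edge together with one of its ends, [true] for the source. *)
Let half_end (h : T * 'I_l * bool) := if h.2 then h.1.2 else tgt h.1.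
(** The half-edges through which the word leaves, resp. reaches, position [j]. *)
Let half_out j := (kappa j, (c j).2).
Let half_in j := (kappa (ord_pred j), ~~ (c (ord_pred j)).2).

Lemma half_end_out j : half_end (half_out j) = rho j.
Proof.
rewrite /half_end /half_out /= tgt_kappa /edge_src /edge_tgt.
by case: (c j).2.
Qed.

Lemma half_end_in j : half_end (half_in j) = rho j.
Proof.
rewrite /half_end /half_in /= tgt_kappa /edge_src /edge_tgt.
by case: (c _).2; rewrite /= ord_predK.
Qed.

(** Otherwise the word would backtrack at [j]. *)
Lemma half_out_neq_in j : half_out j != half_in j.
Proof.
apply: contra (c_red (ord_pred j)); rewrite ord_predK.
by move=> /eqP[e1 _ e2]; rewrite /flip -e1 -e2 -surjective_pairing.
Qed.

(** Every vertex has at least two half-edges, and there are twice as many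
half-edges as edges; with at most as many edges as vertices, every vertex has
exactly two. *)
Lemma few_edges_two_halves : (#|edges| <= #|vertices|)%N ->
  forall j k, rho j = rho k ->
    [set half_out j; half_in j]%SET = [set half_out k; half_in k]%SET.
Proof.
move=> EV.
pose halves := [set h : T * 'I_l * bool | h.1 \in edges]%SET.
pose fib v := [set h in halves | half_end h == v]%SET.
have out_in j : half_out j \in fib (rho j).
  by rewrite !inE /= half_end_out eqxx andbT imset_f.
have in_in j : half_in j \in fib (rho j).
  by rewrite !inE /= half_end_in eqxx andbT imset_f.
have sub j : ([set half_out j; half_in j] \subset fib (rho j))%SET.
  by apply/fintype.subsetP => h /set2P[] ->.
have card2 j : #|[set half_out j; half_in j]%SET| = 2%N.
  by rewrite cards2 half_out_neq_in.
have fib_ge v : v \in vertices -> (2 <= #|fib v|)%N.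
  by case/imsetP => j _ ->; rewrite -(card2 j) subset_leq_card.
have halvesE : (#|halves| = #|edges| * 2)%N.
  have -> : halves = finset.setX edges [set: bool]%SET.
    by apply/finset.setP => h; rewrite !inE andbT.
  by rewrite cardsX cardsT card_bool.
have sum_fib : (\sum_(v in vertices) #|fib v| = #|edges| * 2)%N.
  rewrite -halvesE -sum1_card (partition_big half_end (mem vertices)) /=.
    apply: eq_bigr => v _; rewrite -sum1_card; apply: eq_bigl => h.
    by rewrite [in LHS]inE.
  move=> [e b]; rewrite inE /= => /imsetP[j _ ->]; rewrite /half_end /=.
  by case: b; rewrite ?tgt_kappa imset_f.
have fib_eq j : #|fib (rho j)| = 2%N.
  have : (\sum_(v in vertices) (#|fib v| - 2) == 0)%N.
    rewrite sumnB // sum_fib sum_nat_const subn_eq0 leq_mul2r EV orbT //.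
  rewrite sum_nat_eq0 => /forall_inP/(_ (rho j) (imset_f _ isT)).
  by rewrite subn_eq0 => fle; apply/eqP; rewrite eqn_leq fle fib_ge ?imset_f.
have fibE j : [set half_out j; half_in j]%SET = fib (rho j).
  by apply/eqP; rewrite eqEcard sub card2 fib_eq.
by move=> j k jk; rewrite !fibE jk.
Qed.

Lemma half_inS j : half_in (ordS j) = (kappa j, ~~ (c j).2).
Proof. by rewrite /half_in ordSK. Qed.

(** Of two positions over the same vertex, either both leave it through the same
half-edge, or one leaves it as the other arrives. In the first case they run
together forever, against aperiodicity. In the second they run towards each
other and meet, at a letter that would be its own inverse or that would be
followed by its inverse. *)
Lemma few_edges_injective : (#|edges| <= #|vertices|)%N -> injective rho.
Proof.
move=> /few_edges_two_halves two j k rho_jk.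
have out_of_in i1 i2 : half_in i1 = half_in i2 -> half_out i1 = half_out i2.
  move=> e; have := two i1 i2; rewrite -half_end_in e half_end_in => /(_ erefl).
  move/finset.setP/(_ (half_out i1)); rewrite !inE eqxx /= => /esym/orP[/eqP//|].
  by rewrite -e (negPf (half_out_neq_in i1)).
have in_of_out i1 i2 : half_in i1 = half_out i2 -> half_out i1 = half_in i2.
  move=> e; have := two i1 i2; rewrite -half_end_in e half_end_out => /(_ erefl).
  move/finset.setP/(_ (half_out i1)); rewrite !inE eqxx /= => /esym/orP[|/eqP//].
  by rewrite -e (negPf (half_out_neq_in i1)).
have := two j k rho_jk; move/finset.setP/(_ (half_out j)).
rewrite !inE eqxx /= => /esym/orP[/eqP out_jk|/eqP out_jk].
  have out_eq p : half_out (iter p (@ordS l) j) = half_out (iter p (@ordS l) k).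
    elim: p => //= p IH; apply: out_of_in; rewrite !half_inS.
    by move: IH => /[dup] /(congr1 fst) /= -> /(congr1 snd) /= ->.
  apply: c_aper => p; move: (out_eq p) => [e1 _ e2].
  by rewrite [LHS]surjective_pairing e1 e2 -surjective_pairing.
have out_eq p : half_out (iter p (@ordS l) j) = half_in (iter p (@ord_pred l) k).
  elim: p => //= p IH; apply: in_of_out; rewrite half_inS.
  by move: IH => /[dup] /(congr1 fst) /= -> /(congr1 snd) /= ->; rewrite negbK.
have c_eq p : c (iter p (@ordS l) j) = flip (c (iter p.+1 (@ord_pred l) k)).
  move: (out_eq p) => [e1 _ e2].
  by rewrite [LHS]surjective_pairing e1 e2.
have iterK p i : iter p (@ord_pred l) (iter p (@ordS l) i) = i.
  by elim: p i => //= p IH i; rewrite -iterS iterSr /= ordSK IH.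
(* The positions meet halfway; the parity of the number [m] of steps from [j] to
[k] tells whether they do so on an edge or at a vertex. *)
pose m := (k + l - j)%N.
have km : k = iter m (@ordS l) j.
  apply: val_inj; rewrite /= val_iter_ordS subnKC ?modnDr ?modn_small //.
  by rewrite (leq_trans (ltnW (ltn_ord j))) ?leq_addl.
have mE := odd_double_half m; set p := m./2 in mE.
have kE : k = iter p (@ordS l) (iter (odd m + p) (@ordS l) j).
  by rewrite -iterD addnCA addnn mE.
case: (odd m) kE => /= kE.
  have := c_eq p; rewrite iterS kE iterK ordSK => /(congr1 snd) /= /eqP.
  by case: (c _).2.
have := c_eq p; rewrite iterS kE iterK => e.
by have := c_red (ord_pred (iter p (@ordS l) j)); rewrite ord_predK -e eqxx.
Qed.

Lemma exists_refinement : ~ injective rho ->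
  exists2 rho' : 'I_l -> 'I_l, order_preserving c rho' &
    (#|vertices| < #|[set rho' j | j : 'I_l]%SET|)%N.
Proof.
move=> ninj; have [VE|EV] := ltnP #|vertices| #|edges|.
  have [eta [diff [etaE [j [k rho_jk eta_jk]]]]] := exists_separating_height VE.
  exact: exists_lex_refinement etaE rho_jk eta_jk.
by case: ninj; exact: few_edges_injective.
Qed.

End Refinement.

(** Refinement has to stop, as there are at most [l] values. *)
Lemma exists_stacking : cyclically_reduced c -> aperiodic c ->
  exists2 rho : 'I_l -> 'I_l, injective rho & order_preserving c rho.
Proof.
move=> c_red c_aper.
have refine m (rho : 'I_l -> 'I_l) : order_preserving c rho ->
    (l <= #|[set rho j | j : 'I_l]%SET| + m)%N ->
    exists2 rho : 'I_l -> 'I_l, injective rho & order_preserving c rho.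
  elim: m rho => [|m IH] rho rho_op rho_m;
    have [rho_inj|rho_ninj] := pselect (injective rho); try by exists rho.
    have [rho' _] := exists_refinement rho_op c_red c_aper rho_ninj.
    move/leq_trans/(_ (max_card _)); rewrite card_ord ltnNge.
    by rewrite addn0 in rho_m; rewrite rho_m.
  have [rho' rho'_op lt] := exists_refinement rho_op c_red c_aper rho_ninj.
  by apply: IH rho'_op _; rewrite (leq_trans rho_m) // addnS -addSn leq_add2r.
have [rho rhoP] := exists_rank (fun _ : 'I_l => 0%N).
apply: (refine l rho); last exact: leq_addl.
by move=> j k _; rewrite !rhoP !ltxx.
Qed.
End Stacking.

(** * Counting the permutations that follow a closed path *)

(** Charge [g j] for [f (ordS j)] on the way forward from [m] to [i], and for
[f j] on the rest of the cycle: the value at [i] is counted twice and only the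
value at [m] is left out. *)
Lemma cyclic_max_prod (l : nat) (f g : 'I_l -> nat) (i m : 'I_l) :
  (forall j, f j <= g j)%N -> (forall j, f (ordS j) <= g j)%N -> f m = 1%N ->
  (f i * \prod_j f j <= \prod_j g j)%N.
Proof.
move=> fg fSg fm.
have l0 : (0 < l)%N := leq_ltn_trans (leq0n _) (ltn_ord i).
pose F k := f (iter k (@ordS l) i); pose G k := g (iter k (@ordS l) i).
have inj_iter : injective (fun k : 'I_l => iter k (@ordS l) i).
  move=> j k /(congr1 val); rewrite /= !val_iter_ordS => /eqP.
  by rewrite eqn_modDl !modn_small // => /eqP /val_inj.
have prodE (h : 'I_l -> nat) :
    (\prod_j h j = \prod_(0 <= k < l) h (iter k (@ordS l) i))%N.
  by rewrite big_mkord (reindex_inj inj_iter).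
rewrite !prodE.
have Fl : F l = F 0%N.
  congr f; apply: val_inj; rewrite /= val_iter_ordS modnDr modn_small //.
have [k kl mk] : exists2 k, (k < l)%N & m = iter k (@ordS l) i.
  exists ((m + l - i) %% l)%N; first by rewrite ltn_mod.
  apply: val_inj; rewrite /= val_iter_ordS modnDmr subnKC.
    by rewrite modnDr modn_small.
  by rewrite (leq_trans (ltnW (ltn_ord i))) ?leq_addl.
have Fk : F k = 1%N by rewrite /F -mk.
have catE (h : nat -> nat) :
    (\prod_(0 <= j < l) h j = (\prod_(0 <= j < k) h j) * \prod_(k <= j < l) h j)%N.
  by rewrite (@big_cat_nat _ _ _ k) //= ltnW.
rewrite !catE.
rewrite mulnCA leq_mul //.
  by apply: leq_prod => j _; exact: fg.
rewrite [X in (_ * X)%N]big_ltn // -/(F k) Fk mul1n mulnC -[f i]/(F 0%N) -Fl.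
rewrite -(big_nat_recr l k.+1 F) //= big_add1 /=.
by apply: leq_prod => j _; exact: fSg.
Qed.

Section Counting.
Variables (S : finGroupType) (X : finType) (to : {action S &-> X}).

Section Chain.
Variables (I : finType) (y : I -> X) (rk : I -> nat).

(** The factor by which the stabilizer of the later points of [J] shrinks when
[y j] has to be fixed as well. *)
Definition later_orbit (J : {set I}) j :=
  #|orbit to 'C(y @: [set k in J | (rk j < rk k)%N] | to)%g (y j)|.

(** Orbit-stabilizer, along the chain of stabilizers obtained by fixing the
points of [J] one after the other in decreasing order. *)
Lemma card_stab_chain (J : {set I}) : {in J &, injective rk} ->
  #|[set: S]%SET| = (#|'C(y @: J | to)%g| * \prod_(j in J) later_orbit J j)%N.
Proof.
have [n] := ubnP #|J|; elim: n J => // n IH J Jn rk_inj.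
have [->|[j1 j1J]] := set_0Vmem J.
  rewrite imset0 big_set0 muln1; apply: eq_card => a; rewrite inE.
  by symmetry; apply/astabP => x; rewrite inE.
pose j0 := [arg min_(j < j1 in J) rk j]; pose J' := (J :\ j0)%SET.
have [j0J j0min] : j0 \in J /\ forall j, j \in J -> (rk j0 <= rk j)%N.
  by rewrite /j0; case: arg_minnP.
have JE : J = (j0 |: J')%SET by rewrite finset.setD1K.
have laterE j : j \in J' ->
    [set k in J | (rk j < rk k)%N]%SET = [set k in J' | (rk j < rk k)%N]%SET.
  move=> jJ'; apply/finset.setP => k; rewrite !inE.
  have [->|//] := eqVneq k j0.
  rewrite ltnNge j0min ?andbF //; by move: jJ'; rewrite !inE => /andP[].
have later0 : [set k in J | (rk j0 < rk k)%N]%SET = J'.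
  apply/finset.setP => k; rewrite !inE andbC; have [kJ|] := boolP (k \in J); last first.
    by rewrite !andbF.
  rewrite !andbT ltn_neqAle j0min // andbT; apply/idP/idP; apply: contra => /eqP.
    by move=> ->.
  by move=> e; apply/eqP/rk_inj.
rewrite (IH J') /=; first last.
- by move=> j k; rewrite !inE => /andP[_ jJ] /andP[_ kJ]; exact: rk_inj.
- by move: Jn; rewrite ltnS (cardsD1 j0 J) j0J add1n.
rewrite [in RHS](bigD1 j0) //= /later_orbit later0 [RHS]mulnA.
have -> : 'C(y @: J | to)%g = 'C_('C(y @: J' | to))[y j0 | to]%g.
  rewrite {1}JE imsetU1; apply/finset.setP => a; rewrite finset.in_setI.
  apply/astabP/andP => [fix_a|[/astabP fix_a /astab1P fix1] x].
    split; first by apply/astabP => x xJ; apply: fix_a; rewrite !inE xJ orbT.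
    by apply/astab1P/fix_a; rewrite !inE eqxx.
  by rewrite !inE => /orP[/eqP->//|]; exact: fix_a.
rewrite -[in LHS](card_orbit_stab to 'C(y @: J' | to)%G (y j0)).
rewrite [(#|orbit _ _ _| * _)%N]mulnC; congr (_ * _)%N.
apply: eq_big => [j|j jJ']; first by rewrite !inE andbC.
by rewrite laterE.
Qed.

Lemma later_orbit_gt0 J j : (0 < later_orbit J j)%N.
Proof. by apply/card_gt0P; exists (y j); exact: orbit_refl. Qed.
End Chain.

Hypothesis to_trans : [transitive [set: S]%SET, on [set: X]%SET | to].

Variables (T : finType) (l : nat) (c : 'I_l -> T * bool).
Hypotheses (c_red : cyclically_reduced c) (c_aper : aperiodic c).

(** Two distinct edges with the same letter and the same source would be
consecutive and traversed in opposite directions. *)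
Lemma edge_src_inj j k :
  (c j).1 = (c k).1 -> edge_src c j = edge_src c k -> j = k.
Proof.
rewrite /edge_src => c1.
have [c2|c2] := eqVneq (c j).2 (c k).2.
  by rewrite c2; case: (c k).2 => // /ordS_inj.
have flipjk : c j = flip (c k).
  rewrite [LHS]surjective_pairing c1 /flip; congr pair.
  by move: c2; case: (c j).2; case: (c k).2.
case: ifP => cj2; case: ifP => ck2 jk; move: c2; rewrite cj2 ck2 ?eqxx // => _.
  by move: (c_red k); rewrite -jk flipjk eqxx.
by move: (c_red j); rewrite jk flipjk flipK eqxx.
Qed.

(** The permutations that the letter [t] may take if the word is to follow [x]. *)
Definition movers (x : 'I_l -> X) (t : T) : {set S} := [set s |
  [forall j, ((c j).1 == t) ==> (to (x (edge_src c j)) s == x (edge_tgt c j))]]%SET.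

Lemma moversP x t s : reflect
  (forall j, (c j).1 = t -> to (x (edge_src c j)) s = x (edge_tgt c j))
  (s \in movers x t).
Proof.
rewrite inE; apply: (iffP forallP) => h j; last by apply/implyP => /eqP/h ->.
by move=> /eqP jt; apply/eqP; apply: (implyP (h j)).
Qed.

Section OnePath.
Variables (x : 'I_l -> X) (sigma : T -> S) (rho : 'I_l -> 'I_l).
Hypothesis sigmaP : forall t, sigma t \in movers x t.
Hypothesis x_ninj : ~~ injectiveb x.
Hypotheses (rho_inj : injective rho) (rho_op : order_preserving c rho).

Let f := later_orbit x (fun j => rho j) [set: 'I_l]%SET.
Let letter_edges t := [set j | (c j).1 == t]%SET.
Let g j := later_orbit (x \o edge_src c) (fun k => rho (edge_src c k))
  (letter_edges (c j).1) j.

(** The group on the right fixes fewer points. *)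
Lemma vertex_le_src j : (f (edge_src c j) <= g j)%N.
Proof.
apply/subset_leq_card/imsetS/astabS/fintype.subsetP => z /imsetP[k].
by rewrite !inE => /andP[_ jk] ->; apply: imset_f; rewrite !inE.
Qed.

(** The mover of the letter carries the sources above [j] to targets, which are
above the target of [j] because the order is respected: it conjugates one
stabilizer into the other. *)
Lemma vertex_le_tgt j : (f (edge_tgt c j) <= g j)%N.
Proof.
set s := sigma (c j).1; have /moversP sP := sigmaP (c j).1.
rewrite /f /g /later_orbit -[leqLHS](card_imset _ (act_inj to s^-1%g)).
apply: subset_leq_card.
apply/fintype.subsetP => _ /imsetP[_ /imsetP[a /astabP aP ->] ->].
rewrite -(sP j erefl) -!actM; apply: mem_orbit.
apply/astabP => _ /imsetP[k + ->]; rewrite !inE => /andP[/eqP kj jk].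
rewrite /= !actM sP // aP -?(sP k kj) ?actK // sP //.
by apply: imset_f; rewrite !inE -rho_op.
Qed.

(** The largest position has the whole of [X] as its orbit, and the lower of two
positions with the same point has an orbit of size one. *)
Lemma path_orbit_bound :
  (#|X| * \prod_j f j <= \prod_t \prod_(j in letter_edges t)
     later_orbit (x \o edge_src c) (fun k => rho (edge_src c k)) (letter_edges t) j)%N.
Proof.
have [j [k jk xjk]] : exists j, exists2 k, (rho j < rho k)%N & x j = x k.
  case/injectivePn: x_ninj => j [k jk xjk].
  have := jk; rewrite -(inj_eq rho_inj) -val_eqE /= neq_ltn => /orP[] lt.
    by exists j, k.
  by exists k, j.
have [jmax _ jmaxP] := @arg_maxnP 'I_l j xpredT (fun i => rho i) isT.
have fmax : f jmax = #|X|.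
  rewrite -cardsT -(atransP to_trans (x jmax) (finset.in_setT _)) /f /later_orbit.
  congr #|orbit to _ _|.
  apply/finset.setP => a; rewrite [RHS]finset.in_setT; apply/astabP => z /imsetP[k1].
  by rewrite !inE /= ltnNge (jmaxP k1 isT : (_ <= _)%N).
have fj : f j = 1%N.
  apply/eqP/cards1P; exists (x j); apply/orbit1P/afixP => a /astabP; apply.
  by rewrite xjk; apply: imset_f; rewrite !inE.
rewrite -fmax.
have -> : (\prod_t \prod_(j in letter_edges t) later_orbit (x \o edge_src c)
    (fun k => rho (edge_src c k)) (letter_edges t) j = \prod_j g j)%N.
  rewrite [RHS](partition_big (fun j => (c j).1) predT) //=.
  apply: eq_bigr => t _; apply: eq_big => [i|i]; first by rewrite inE.
  by rewrite inE => /eqP <-.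
apply: (cyclic_max_prod jmax _ _ fj) => i.
  have := vertex_le_src i; have := vertex_le_tgt i.
  by rewrite /edge_src /edge_tgt; case: (c i).2.
have := vertex_le_src i; have := vertex_le_tgt i.
by rewrite /edge_src /edge_tgt; case: (c i).2.
Qed.

(** Two movers of the same letter differ by an element fixing all its sources. *)
Lemma movers_le t :
  (#|movers x t| <= #|'C((x \o edge_src c) @: letter_edges t | to)%g|)%N.
Proof.
rewrite -(card_imset _ (mulIg (sigma t)^-1%g)); apply: subset_leq_card.
apply/fintype.subsetP => _ /imsetP[a /moversP aP ->].
have /moversP sP := sigmaP t.
apply/astabP => _ /imsetP[j + ->]; rewrite inE => /eqP jt /=.
by rewrite actM aP // -sP // actK.
Qed.

Lemma path_movers_bound (R : realFieldType) :
  \prod_t (#|movers x t|%:R / #|[set: S]%SET|%:R) <=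
    #|'C(x @: [set: 'I_l]%SET | to)%g|%:R / #|[set: S]%SET|%:R / #|X|%:R :> R.
Proof.
have S0 : (0 < #|[set: S]%SET|)%N by rewrite cardG_gt0.
have C0 (A : {set X}) : (0 < #|'C(A | to)%g|)%N by rewrite cardG_gt0.
have X0 : (0 < #|X|)%N.
  case/injectivePn: x_ninj => j _; apply/card_gt0P; by exists (x j).
have rinj t : {in letter_edges t &, injective (fun k => rho (edge_src c k) : nat)}.
  move=> j k; rewrite !inE => /eqP jt /eqP kt /val_inj/rho_inj.
  by apply: edge_src_inj; rewrite jt.
pose G t := (\prod_(j in letter_edges t) later_orbit (x \o edge_src c)
  (fun k => rho (edge_src c k)) (letter_edges t) j)%N.
have chain t : #|[set: S]%SET| =
    (#|'C((x \o edge_src c) @: letter_edges t | to)%g| * G t)%N.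
  exact: card_stab_chain (rinj t).
have chainT : #|[set: S]%SET| =
    (#|'C(x @: [set: 'I_l]%SET | to)%g| * \prod_j f j)%N.
  rewrite (@card_stab_chain _ x (fun j => rho j) [set: 'I_l]%SET).
    by congr (_ * _)%N; apply: eq_big => j //; rewrite inE.
  by move=> j k _ _ /val_inj/rho_inj.
have G0 t : (0 < G t)%N by apply: prodn_gt0 => j; exact: later_orbit_gt0.
have F0 : (0 < \prod_j f j)%N by apply: prodn_gt0 => j; exact: later_orbit_gt0.
apply: (@le_trans _ _ (\prod_t (G t)%:R^-1)).
  apply: ler_prod => t _; rewrite divr_ge0 //= (chain t) natrM invfM mulrA.
  rewrite ler_piMl ?invr_ge0 // ler_pdivrMr ?ltr0n // mul1r ler_nat.
  exact: movers_le.
rewrite prodfV -natr_prod [in leRHS]chainT natrM invfM mulrA.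
rewrite divff ?pnatr_eq0 -?lt0n // mul1r -invfM -natrM.
rewrite lef_pV2 ?posrE ?ltr0n ?muln_gt0 ?F0 ?X0 ?prodn_gt0 //.
by rewrite ler_nat mulnC; exact: path_orbit_bound.
Qed.
End OnePath.

(** By orbit-stabilizer, a tuple contributes at most the inverse of the product
of [#|X|] and the size of its orbit. *)
Lemma sum_noninjective_movers (R : realFieldType) :
  \sum_(x : l.-tuple X | ~~ injectiveb (tnth x))
     \prod_t (#|movers (tnth x) t|%:R / #|[set: S]%SET|%:R) <=
  #|orbit (to * l)%act [set: S]%SET @: [set: l.-tuple X]%SET|%:R / #|X|%:R :> R.
Proof.
have [rho rho_inj rho_op] := exists_stacking c_red c_aper.
pose orb (x : l.-tuple X) := orbit (to * l)%act [set: S]%SET x.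
have orb0 x : (0 < #|orb x|)%N by apply/card_gt0P; exists x; exact: orbit_refl.
have term x : ~~ injectiveb (tnth x) ->
    \prod_t (#|movers (tnth x) t|%:R / #|[set: S]%SET|%:R) <=
    #|orb x|%:R^-1 / #|X|%:R :> R.
  move=> x_ninj; have [/forallP sP|] := boolP [forall t, movers (tnth x) t != finset.set0].
    pose sigma t := xchoose (set0Pn _ (sP t)).
    have sigmaP t : sigma t \in movers (tnth x) t by exact: xchooseP.
    apply: (le_trans (path_movers_bound sigmaP x_ninj rho_inj rho_op R)).
    rewrite ler_wpM2r ?invr_ge0 ?ler0n //.
    rewrite -(card_orbit_stab (to * l)%act [set: S]%G x) -/(orb x).
    have -> : 'C_([set: S]%SET)[x | to * l]%g = 'C(tnth x @: [set: 'I_l]%SET | to)%g.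
      apply/finset.setP => a; rewrite finset.in_setI finset.in_setT /=.
      apply/astab1P/astabP => [xa _ /imsetP[j _ ->]|xa].
        by rewrite -{2}xa tnth_map.
      by apply: eq_from_tnth => j; rewrite tnth_map xa // imset_f.
    by rewrite natrM invfM mulrC -mulrA mulVf ?mulr1 // pnatr_eq0 -lt0n cardG_gt0.
  rewrite negb_forall => /existsP[t]; rewrite negbK => /eqP t0.
  by rewrite (bigD1 t) //= t0 cards0 !mul0r divr_ge0 ?invr_ge0.
apply: (@le_trans _ _ (\sum_(x : l.-tuple X) #|orb x|%:R^-1 / #|X|%:R)).
  rewrite big_mkcond /=; apply: ler_sum => x _; case: ifP => [|_]; first exact: term.
  by rewrite divr_ge0 ?invr_ge0.
rewrite -mulr_suml ler_wpM2r ?invr_ge0 //.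
rewrite (partition_big orb [in orb @: [set: l.-tuple X]%SET]) /=; last first.
  by move=> x _; exact: imset_f.
rewrite -sumr_const; apply: ler_sum => O /imsetP[x _ ->].
rewrite (eq_bigr (fun=> #|orb x|%:R^-1)) => [|z /eqP -> //].
have orbE : #|[pred z | orb z == orb x]| = #|orb x|.
  by apply: eq_card => z; rewrite [LHS]inE; apply/eqP/idP => /orbit_eqP.
rewrite sumr_const (orbE : #|_| = _).
by rewrite -[leLHS]mulr_natr mulVf // pnatr_eq0 -lt0n.
Qed.

End Counting.

(** * Cyclically reduced words *)

Definition letter_val (T : Type) (K : groupType) (k : T -> K) (a : T * bool) : K :=
  if a.2 then k a.1 else ((k a.1)^-1)%g.

Section Words.
Variable T : choiceType.
Implicit Types (a b : T * bool) (s t u z : seq (T * bool)) (w v : freegroup T).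

Lemma letter_val_flip (K : groupType) (k : T -> K) a :
  letter_val k (flip a) = ((letter_val k a)^-1)%g.
Proof. by case: a => x []; rewrite /letter_val //= invgK. Qed.

Lemma freegroup_prod w :
  w = (\prod_(a <- w) letter_val (@freegroup_gen T) a)%g.
Proof.
case: w => s rs; elim: s rs => [|a s IH] rs.
  by rewrite big_nil; apply: val_inj.
rewrite big_cons /= -(IH (reduced_behead rs)).
have -> : letter_val (@freegroup_gen T) a = @FreeGroup _ [:: a] isT.
  by case: a {rs} => x []; apply: val_inj.
apply: val_inj => /=; case: s rs {IH} => //= b s /andP[/negPf ->] //.
Qed.

Lemma monoid_morphism_prod (K : groupType) (alpha : freegroup T -> K) s :
  monoid.monoid_morphism alpha ->
  alpha (\prod_(a <- s) letter_val (@freegroup_gen T) a)%g =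
  (\prod_(a <- s) letter_val (fun x => alpha (freegroup_gen x)) a)%g.
Proof.
move=> [alpha1 alphaM]; rewrite (big_morph alpha alphaM alpha1).
apply: eq_bigr => -[x []] _ //; rewrite /letter_val /=.
have : (alpha (freegroup_gen x) * alpha (freegroup_gen x)^-1 = 1)%g.
  by rewrite -alphaM mulgV alpha1.
by move/(congr1 (mulg (alpha (freegroup_gen x))^-1%g)); rewrite mulKg mulg1.
Qed.

(** Cancel the last letter against the first as long as they are inverse to each
other. *)
Lemma exists_cyclic_reduction w : exists (u : freegroup T) v,
  w = (v ^ u)%g /\ path.cycle (fun a b => b != flip a) v.
Proof.
have [n] := ubnP (size w); elim: n w => // n IH w wn.
have neq_flip a b : (a != flip b) = (b != flip a).
  by rewrite -[in LHS](inj_eq (can_inj (@flipK T))) flipK eq_sym.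
case wE : (word w) => [|a s]; first by exists 1%g, w; rewrite conjg1 wE.
case/lastP: s wE => [|s b] wE.
  by exists 1%g, w; rewrite conjg1 wE /= andbT /flip; case: a {wE} => x [];
    rewrite xpair_eqE eqxx.
have rw : reduced (a :: rcons s b) by rewrite -wE; exact: valP.
have [ba|ba] := eqVneq b (flip a); last first.
  exists 1%g, w; rewrite conjg1 wE /= rcons_path last_rcons; split=> //.
  by rewrite neq_flip ba andbT.
have rs : reduced s.
  by move: rw; rewrite /reduced /= rcons_path => /andP[/path_sorted].
have [|u [v [sE v_cyc]]] := IH (FreeGroup rs).
  by move: wn; rewrite wE /= size_rcons ltnS => /ltnW.
exists (u * (letter_val (@freegroup_gen T) a)^-1)%g, v; split=> //.
rewrite conjgM -sE [LHS]freegroup_prod wE big_cons big_rcons /= ba letter_val_flip.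
by rewrite [in RHS](freegroup_prod (FreeGroup rs)) conjgE invgK mulgA.
Qed.

(** Euclid's algorithm on the lengths. *)
Lemma commuting_words u t : u ++ t = t ++ u -> exists z m n,
  u = flatten (nseq m z) /\ t = flatten (nseq n z).
Proof.
have [N] := ubnP (size u + size t); elim: N u t => // N IH u t.
wlog ut : u t / (size u <= size t)%N => [wl|] Nut eq_ut.
  have [le|/ltnW le] := leqP (size u) (size t); first exact: wl.
  by have [||z [m [n [? ?]]]] := wl t u le; [rewrite addnC|by []|exists z, n, m].
case: u => [|a u] in ut Nut eq_ut *.
  by exists t, 0%N, 1%N; rewrite /= cats0.
have tE : t = (a :: u) ++ drop (size (a :: u)) t.
  have := congr1 (take (size (a :: u))) eq_ut.
  by rewrite take_size_cat // takel_cat // => {1}->; rewrite cat_take_drop.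
set t' := drop _ t in tE.
have [||z [m [n [uE t'E]]]] := IH (a :: u) t'.
- have := congr1 size tE; rewrite size_cat => tS.
  move: Nut; rewrite tS /= !addSn !ltnS addnS; apply: leq_trans.
  by rewrite !ltnS leq_addl.
- have := eq_ut; rewrite {1 2}tE -!catA => /eqP.
  by rewrite eqseq_cat // eqxx => /eqP.
exists z, m, (m + n)%N; split=> //.
by rewrite nseqD flatten_cat -uE -t'E.
Qed.

Lemma prod_flatten_nseq (K : groupType) (h : T * bool -> K) n z :
  (\prod_(a <- flatten (nseq n z)) h a = (\prod_(a <- z) h a) ^+ n)%g.
Proof.
elim: n => [|n IH]; first by rewrite big_nil.
by rewrite /= big_cat /= IH expgS.
Qed.

Lemma proper_power_conj v w : proper_power v -> proper_power (v ^ w)%g.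
Proof.
move=> [z [k [k2 ->]]]; exists (z ^ w)%g, k; split=> //.
by elim: k {k2} => [|k IH]; rewrite ?conj1g // !expgS conjMg IH.
Qed.

(** A rotation of the word that leaves it invariant cuts it into two commuting
words, so that it is a power of their common root. *)
Lemma periodic_proper_power s (j k : 'I_(size s)) : (j < k)%N ->
  (forall p, tnth (in_tuple s) (iter p (@ordS _) j) =
             tnth (in_tuple s) (iter p (@ordS _) k)) ->
  proper_power (\prod_(a <- s) letter_val (@freegroup_gen T) a)%g.
Proof.
move=> jk per; set h := letter_val _.
have [a0 _] : exists a0, a0 \in s by exists (tnth (in_tuple s) j); rewrite mem_tnth.
have s0 : (0 < size s)%N := leq_ltn_trans (leq0n _) (ltn_ord j).
have nth_rot_iter (i : 'I_(size s)) p : (p < size s)%N ->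
    nth a0 (seq.rot i s) p = tnth (in_tuple s) (iter p (@ordS _) i).
  move=> ps; rewrite (tnth_nth a0) /= val_iter_ordS /seq.rot nth_cat size_drop.
  rewrite ltn_subRL; case: ltnP => ips; first by rewrite nth_drop modn_small.
  have lt : (i + p - size s < i)%N by rewrite ltn_subLR // addnC ltn_add2r.
  rewrite subnBA ?(ltnW (ltn_ord i)) // [(p + i)%N]addnC nth_take //.
  by rewrite -[in RHS](subnK ips) modnDr modn_small // (ltn_trans lt).
have rot_eq : seq.rot j s = seq.rot k s.
  apply: (@eq_from_nth _ a0) => [|p]; rewrite !size_rot // => ps.
  by rewrite !nth_rot_iter.
have /commuting_words[z [m [n [tE dE]]]] :
    take (k - j) (seq.rot j s) ++ drop (k - j) (seq.rot j s) =
    drop (k - j) (seq.rot j s) ++ take (k - j) (seq.rot j s).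
  by rewrite cat_take_drop -/(seq.rot _ _) -rotD subnK ?(ltnW jk) // ltnW.
have size_t : size (take (k - j) (seq.rot j s)) = (k - j)%N.
  by rewrite size_take size_rot (leq_ltn_trans (leq_subr _ _) (ltn_ord k)).
have m0 : (0 < m)%N.
  by case: m tE => // tE; move: jk; rewrite -subn_gt0 -size_t tE.
have n0 : (0 < n)%N.
  case: n dE => // /(congr1 size); rewrite size_drop size_rot /= => /eqP.
  rewrite subn_eq0 => /leq_trans/(_ (leq_subr _ _)).
  by rewrite leqNgt ltn_ord.
have rotE : (\prod_(a <- seq.rot j s) h a = (\prod_(a <- z) h a) ^+ (m + n))%g.
  rewrite -[seq.rot j s](cat_take_drop (k - j)) big_cat /= tE dE.
  by rewrite !prod_flatten_nseq expgnDr.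
have -> : (\prod_(a <- s) h a =
    (\prod_(a <- seq.rot j s) h a) ^ (\prod_(a <- drop j s) h a))%g.
  rewrite /seq.rot big_cat /= conjgE mulgA mulKg -{1}(cat_take_drop j s).
  by rewrite big_cat.
apply: proper_power_conj; rewrite rotE.
by exists (\prod_(a <- z) h a)%g, (m + n)%N; split=> //; exact: leq_add m0 n0.
Qed.

Lemma exists_aperiodic_conjugate w : ~ proper_power w ->
  exists (l : nat) (c : l.-tuple (T * bool)) (u : freegroup T),
    [/\ (0 < l)%N, w = ((\prod_(a <- c) letter_val (@freegroup_gen T) a) ^ u)%g,
        cyclically_reduced (tnth c) & aperiodic (tnth c)].
Proof.
move=> w_npow; have [u [v [wE v_cyc]]] := exists_cyclic_reduction w.
pose s : seq (T * bool) := v.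
have v_npow : ~ proper_power (\prod_(a <- s) letter_val (@freegroup_gen T) a)%g.
  by move=> /(proper_power_conj u); rewrite -freegroup_prod -wE.
exists (size s), (in_tuple s), u; split.
- rewrite lt0n size_eq0; apply: contra_notN v_npow => /eqP ->.
  by exists 1%g, 2; rewrite big_nil expg1n.
- by rewrite -freegroup_prod.
- move: v_cyc; rewrite -/s; case sE : s => [|a t].
    by move=> _ [].
  move=> /(pathP a) step j.
  have := step j; rewrite size_rcons => /(_ (ltn_ord j)).
  rewrite -rcons_cons !nth_rcons ltn_ord !(tnth_nth a) /=.
  have := ltn_ord j; rewrite /= [X in (_ < X)%N]/= ltnS leq_eqVlt.
  case: ltngtP => // [jt _|-> _]; first by rewrite modn_small.
  by rewrite modnn.
- move=> j k per; have [jk|kj|/val_inj//] := ltngtP j k.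
    by case: v_npow; exact: periodic_proper_power jk per.
  by case: v_npow; apply: (periodic_proper_power kj) => p; rewrite per.
Qed.
End Words.

(** * The induced representation *)

Section MatrixContinuity.
Variables (T : topologicalType) (m n : nat) (F : numFieldType).

Lemma mx_continuous_coord (f : T -> 'M[F^o]_(m, n)) :
  continuous f <-> forall i j, continuous (fun x => f x i j : F^o).
Proof.
split=> [cf i j x|cf x A [P nP PA]].
  apply: (@continuous_comp _ _ _ f (fun M : 'M[F^o]_(m, n) => M i j)).
    exact: cf.
  exact: coord_continuous.
have : \forall y \near x, forall i j, P i j (f y i j).
  apply: filter_forall => i; apply: filter_forall => j.
  exact: cf (nP i j).
by apply: filterS => y; exact: PA.
Qed.
End MatrixContinuity.

Section NontrivialIrreducible.
Variables (R : realType) (G : topologicalGroupType) (d : nat).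
Variables (rho : G -> 'M[R[i]]_d).
Hypothesis (rho_irr : irreducible_repr rho).
Hypothesis rho_nontriv : (fun g => \tr (rho g)) <> (fun=> 1).

(** A trivial representation is irreducible in dimension one only, where its
character is the constant [1]. *)
Lemma nontrivial_moves : ~ forall g, rho g = 1%:M.
Proof.
case: rho_irr => d0 irr triv; apply: rho_nontriv; apply/funext => g.
pose i0 := Ordinal d0; pose U : 'M[R[i]]_d := delta_mx i0 i0.
have /irr : forall g, stablemx U (rho g) by move=> h; rewrite triv mulmx1.
have U0 : U != 0.
  by apply/eqP => /matrixP/(_ i0 i0)/eqP; rewrite !mxE !eqxx oner_eq0.
move=> /(_ U0); rewrite /row_full mxrank_delta => /eqP d1.
by rewrite triv mxtrace_scalar -d1.
Qed.

(** A nonzero fixed row would span a stable line, hence the whole space, and the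
representation would be trivial. *)
Lemma row_fixed_eq0 (u : 'rV[R[i]]_d) : (forall g, u *m rho g = u) -> u = 0.
Proof.
case: rho_irr => d0 irr fix_u; apply/eqP; apply: contrapT => /negP u0.
have full : row_full <<u>>%MS.
  apply: irr => [g|]; last by rewrite -mxrank_eq0 genmxE mxrank_eq0.
  by rewrite (eqmxMr _ (genmxE u)) genmxE fix_u.
apply: nontrivial_moves => g; apply/row_matrixP => i.
have /submxP[D rowE] : (row i (1%:M : 'M[R[i]]_d) <= u)%MS.
  by rewrite -(genmxE u) submx_full.
have -> : row i (rho g) = row i 1%:M *m rho g by rewrite -row_mul mul1mx.
by rewrite rowE -mulmxA fix_u.
Qed.

(** The rows killed by [M] form a stable subspace, which contains the rows of
every [rho g - 1]. *)
Lemma mx_fixed_eq0 (M : 'M[R[i]]_d) : (forall g, rho g *m M = M) -> M = 0.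
Proof.
case: rho_irr => d0 irr fix_M; apply/eqP; apply: contrapT => /negP M0.
have stab g : stablemx (kermx M) (rho g).
  by apply/sub_kermxP; rewrite -mulmxA fix_M mulmx_ker.
have ker0 : kermx M = 0.
  apply/eqP; apply: contrapT => /negP /(irr _ stab); rewrite /row_full mxrank_ker.
  move=> /eqP dr; have := subnK (rank_leq_row M); rewrite dr => /eqP.
  rewrite -[X in _ == X]addn0 eqn_add2l.
  by rewrite mxrank_eq0; exact/negP.
apply: nontrivial_moves => g; apply/eqP; rewrite -subr_eq0.
suff : (rho g - 1%:M <= kermx M)%MS by rewrite ker0 submx0.
by apply/sub_kermxP; rewrite mulmxBl fix_M mul1mx subrr.
Qed.
End NontrivialIrreducible.

Section InducedRepresentation.
Variables (R : realType) (G : topologicalGroupType) (S : finGroupType) (X : finType).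
Variables (to : {action S &-> X}) (d : nat) (rho : G -> 'M[R[i]]_d).
Local Notation C := R[i].
Local Notation N := (#|X| * d)%N.
Local Notation wr := (wreath G to).

Definition at_site x (k : G) : wr := (fun y => if y == x then k else 1%g, 1%g).

(** A vector of the induced representation is handled as a matrix, whose row
indexed by a point of [X] is its component in the summand of that point. *)
Definition site (A : 'M[C]_(#|X|, d)) (x : X) : 'rV[C]_d := row (enum_rank x) A.

Definition from_sites (u : X -> 'rV[C]_d) : 'M[C]_(#|X|, d) :=
  \matrix_(i, b) u (enum_val i) 0 b.

Lemma site_from_sites u x : site (from_sites u) x = u x.
Proof. by apply/rowP => b; rewrite !mxE enum_rankK. Qed.

Lemma eq_sites A B : (forall x, site A x = site B x) -> A = B.
Proof.
move=> AB; apply/row_matrixP => i; have := AB (enum_val i).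
by rewrite /site enum_valK.
Qed.

(** The right action by monomial block matrices. *)
Definition wreath_act (g : wr) (A : 'M[C]_(#|X|, d)) : 'M[C]_(#|X|, d) :=
  from_sites (fun y => let x := to y (g.2 : S)^-1%g in site A x *m rho (g.1 x)).

Lemma wreath_act_is_linear g : linear (wreath_act g).
Proof.
move=> a A B; apply: eq_sites => y.
rewrite /wreath_act site_from_sites /site !linearP /= !mulmxDl -!scalemxAl.
by rewrite -![row _ (from_sites _)]/(site _ _) !site_from_sites.
Qed.

HB.instance Definition _ g :=
  GRing.isLinear.Build C _ _ _ (wreath_act g) (wreath_act_is_linear g).

Definition induced_repr (g : wr) : 'M[C]_N := lin_mx (wreath_act g).

Hypothesis rho_cont : continuous_repr rho.

Let rho1 : rho 1%g = 1%:M. Proof. by case: rho_cont. Qed.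
Let rhoM g h : rho (g * h)%g = rho g *m rho h. Proof. by case: rho_cont. Qed.

Lemma wreath_act1 A : wreath_act 1%g A = A.
Proof.
by apply: eq_sites => y; rewrite site_from_sites /= invg1 act1 rho1 mulmx1.
Qed.

Lemma wreath_actM g h A : wreath_act (g * h)%g A = wreath_act h (wreath_act g A).
Proof.
apply: eq_sites => y; rewrite !site_from_sites /= invMg actM.
by rewrite actKV rhoM mulmxA [in RHS]site_from_sites.
Qed.

(** The entries depend on [g] through a single coordinate and the image of a
single point, whence the continuity of the representation. *)
Lemma induced_reprE g x y a b :
  induced_repr g (mxvec_index x a) (mxvec_index y b) =
  (to (enum_val x) g.2 == enum_val y)%:R * rho (g.1 (enum_val x)) a b.
Proof.
have -> : induced_repr g (mxvec_index x a) (mxvec_index y b) =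
    wreath_act g (delta_mx x a) y b.
  by rewrite mxE /= mxvecE vec_mx_delta.
rewrite mxE /=. set z := to (enum_val y) _.
have -> : site (delta_mx x a) z = (enum_rank z == x)%:R *: delta_mx 0 a.
  by apply/rowP => b'; rewrite !mxE eqxx -natrM mulnb.
rewrite -scalemxAl -rowE !mxE.
have -> : (to (enum_val x) g.2 == enum_val y) = (enum_rank z == x).
  rewrite (can2_eq (actK to g.2) (actKV to g.2)) -/z.
  by rewrite -(inj_eq enum_val_inj) enum_rankK eq_sym.
by have [<-|_] := eqVneq; rewrite ?enum_rankK // !mul0r.
Qed.

Lemma induced_trace g : \tr (induced_repr g) = induced_char (fun h => \tr (rho h)) g.
Proof.
rewrite /mxtrace /induced_char.
pose F x a : C := induced_repr g (mxvec_index x a) (mxvec_index x a).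
rewrite (reindex _ (curry_mxvec_bij _ _)) /=.
rewrite (eq_bigr (fun p => F p.1 p.2)) => [|[x a] //].
rewrite -(pair_bigA _ F) /F /=.
rewrite [RHS]big_mkcond /= [LHS](reindex (@enum_rank X)) /=; last first.
  exact/onW_bij/enum_rank_bij.
apply: eq_bigr => x _.
rewrite (eq_bigr (fun a => (to x g.2 == x)%:R * rho (g.1 x) a a)) => [|a _].
  by rewrite -mulr_sumr; case: eqP => _; rewrite ?mul1r ?mul0r.
by rewrite induced_reprE enum_rankK.
Qed.

Lemma induced_continuous : continuous (induced_repr : wr -> 'M[C^o]_N).
Proof.
case: rho_cont => _ _ /mx_continuous_coord cont; apply/mx_continuous_coord => i j.
case/mxvec_indexP: i => x a; case/mxvec_indexP: j => y b g.
have near_eq : \forall h \near g, (to (enum_val x) g.2 == enum_val y)%:R *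
    rho (h.1 (enum_val x)) a b = induced_repr h (mxvec_index x a) (mxvec_index y b).
  have := @wreath_snd_near G S X to g; apply: filterS => h hg.
  by rewrite induced_reprE hg.
apply: cvg_trans; first exact: near_eq_cvg near_eq.
rewrite induced_reprE; apply: cvgMr.
apply: (@continuous_comp _ _ _ (fun h : wr => h.1 (enum_val x) : G)
  (fun k => rho k a b : C^o)); first exact: wreath_fst_continuous.
exact: cont.
Qed.

Lemma induced_continuous_repr : continuous_repr induced_repr.
Proof.
split; last exact: induced_continuous.
  apply/row_matrixP => i; rewrite !rowE -[delta_mx 0 i]vec_mxK /induced_repr.
  by rewrite mul_vec_lin /= wreath_act1 mulmx1.
move=> g h; apply/row_matrixP => i.
rewrite !rowE -[delta_mx 0 i]vec_mxK mulmxA /induced_repr.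
by rewrite !mul_vec_lin /= wreath_actM.
Qed.

Hypothesis to_trans : [transitive [set: S]%SET, on [set: X]%SET | to].
Hypothesis rho_irr : irreducible_repr rho.
Hypothesis rho_nontriv : (fun g => \tr (rho g)) <> (fun=> 1).

Let block x (u : 'rV[C]_d) : 'M[C]_(#|X|, d) :=
  from_sites (fun y => if y == x then u else 0).

Let block_is_linear x : linear (block x).
Proof.
move=> a u v; apply: eq_sites => y; rewrite site_from_sites.
rewrite /site linearP /= -![row _ (block _ _)]/(site _ _) !site_from_sites.
by case: eqP => // _; rewrite scaler0 addr0.
Qed.

HB.instance Definition _ x :=
  GRing.isLinear.Build C _ _ _ (block x) (block_is_linear x).

Lemma act_at_site x k A :
  wreath_act (at_site x k) A = A + block x (site A x *m rho k - site A x).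
Proof.
apply: eq_sites => y; rewrite site_from_sites /= invg1 act1.
rewrite /site linearD /= -![row _ (block _ _)]/(site _ _) !site_from_sites.
by case: eqP => [->|_]; rewrite ?rho1 ?mulmx1 ?addr0 // addrC subrK.
Qed.

Lemma act_permutation x s u :
  wreath_act ((fun=> 1%g, s) : wr) (block x u) = block (to x s) u.
Proof.
apply: eq_sites => y; rewrite [LHS]site_from_sites /= rho1 mulmx1.
rewrite [LHS]site_from_sites [RHS]site_from_sites.
by rewrite (can2_eq (actKV to s) (actK to s)).
Qed.

Lemma induced_irreducible : irreducible_repr induced_repr.
Proof.
have [d0 irr] := rho_irr.
have /imsetP[x0 _ X_orb] := to_trans.
split=> [|U U_stab U0].
  by rewrite muln_gt0 d0 andbT; apply/card_gt0P; exists x0.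
pose inU A := (mxvec A <= U)%MS.
have inU_act g A : inU A -> inU (wreath_act g A).
  rewrite /inU -mul_vec_lin => AU; apply: submx_trans (U_stab g).
  exact: submxMr.
have inUD A B : inU A -> inU B -> inU (A + B).
  by rewrite /inU linearD; exact: addmx_sub.
have inUN A : inU A -> inU (- A) by rewrite /inU linearN eqmx_opp.
(* A nonzero vector of [U] has a nonzero component, which some group element
   moves; the displacement is a nonzero vector supported in one summand. *)
have [x [u u0 xu]] : exists x, exists2 u : 'rV[C]_d, u != 0 & inU (block x u).
  have /rowV0Pn[z zU z0] := U0.
  have [x zx] : exists x, site (vec_mx z) x != 0.
    apply: contrapT => nx; case/negP: z0; rewrite -[z]vec_mxK.
    rewrite [vec_mx z](_ : _ = 0) ?linear0 //; apply: eq_sites => x.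
    rewrite [RHS]row0; apply/eqP; apply: contrapT => /negP zx.
    by apply: nx; exists x.
  have [k zk] : exists k, site (vec_mx z) x *m rho k != site (vec_mx z) x.
    apply: contrapT => nk; case/negP: zx.
    apply/eqP; apply: (row_fixed_eq0 rho_irr rho_nontriv) => g.
    apply/eqP; apply: contrapT => /negP zk.
    by apply: nk; exists g.
  exists x, (site (vec_mx z) x *m rho k - site (vec_mx z) x).
    by rewrite subr_eq0.
  have zU' : inU (vec_mx z) by rewrite /inU vec_mxK.
  have := inUD _ _ (inU_act (at_site x k) _ zU') (inUN _ zU').
  by rewrite act_at_site addrAC subrr add0r.
pose L := lin1_mx (mxvec \o block x).
have inB v : (v <= kermx (L *m cokermx U))%MS = inU (block x v).
  have vL : v *m L = mxvec (block x v) by rewrite mul_rV_lin1.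
  rewrite /inU [in RHS]submxE -vL -(mulmxA v L).
  by apply/sub_kermxP/eqP.
have Bx v : inU (block x v).
  rewrite -inB submx_full //; apply: irr => [k|].
    apply/row_subP => i; rewrite row_mul inB.
    set v' := row i _; have : inU (block x v') by rewrite -inB row_sub.
    move=> /(inU_act (at_site x k)) act_v; rewrite /inU.
    have -> : block x (v' *m rho k) = wreath_act (at_site x k) (block x v').
      rewrite act_at_site site_from_sites eqxx -linearD /=.
      by rewrite addrC subrK.
    exact: act_v.
  apply/rowV0Pn; exists u => //.
  by rewrite inB.
have By y v : inU (block y v).
  have : y \in orbit to [set: S]%SET x.
    by rewrite (atransP to_trans) ?finset.in_setT.
  case/imsetP => s _ ->; rewrite -act_permutation; exact: inU_act.
rewrite -sub1mx; apply/row_subP => i; rewrite row1 -[delta_mx 0 i]vec_mxK.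
set A := vec_mx _; have -> : A = \sum_x block x (site A x).
  apply: eq_sites => y; rewrite {2}/site linear_sum /= (bigD1 y) //=.
  rewrite -[row _ (block _ _)]/(site _ _) site_from_sites eqxx big1 ?addr0 // => z zy.
  by rewrite -[row _ (block _ _)]/(site _ _) site_from_sites eq_sym (negPf zy).
by rewrite linear_sum; apply: summx_sub => y _; exact: By.
Qed.

End InducedRepresentation.

Lemma induced_char_irreducible (R : realType) (G : topologicalGroupType)
    (S : finGroupType) (X : finType) (to : {action S &-> X}) (d : nat)
    (phi : G -> R[i]) :
  [transitive [set: S]%SET, on [set: X]%SET | to] ->
  irreducible_character d phi -> phi <> (fun=> 1) ->
  irreducible_character (#|X| * d)%N (induced_char phi : wreath G to -> R[i]).
Proof.
move=> to_trans [rho [rho_cont rho_irr phiE]] phi_nontriv.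
have phi_tr : phi = fun g => \tr (rho g) by apply/funext.
exists (@induced_repr _ _ _ _ to _ rho); split.
- exact: induced_continuous_repr.
- by apply: induced_irreducible; rewrite -?phi_tr.
- by move=> g; rewrite induced_trace phi_tr.
Qed.

(** * Bounded measurable functions and their expectations *)

Section ComplexNorm.
Variable R : realType.
Implicit Type z : R[i].

Lemma normc_ge_Im z : (`|complex.Im z|%:C <= `|z|)%C.
Proof. by rewrite normc_def lecR -sqrtr_sqr ler_wsqrtr // lerDr sqr_ge0. Qed.

Lemma normc_le_ReD_Im z : `|z| <= ((`|complex.Re z| + `|complex.Im z|)%:C)%C.
Proof.
rewrite [z in leLHS]complexE (le_trans (ler_normD _ _)) // normrM.
have -> : `|'i%C : R[i]| = 1 by rewrite normc_def /= expr0n expr1n add0r sqrtr1.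
by rewrite mul1r !normc_def /= !expr0n /= !addr0 !sqrtr_sqr -[_ + _]rmorphD.
Qed.
End ComplexNorm.

Section BoundedMeasurable.
Variables (R : realType) (d : measure_display) (T : measurableType d).
Local Notation Re := complex.Re.
Local Notation Im := complex.Im.

Definition bounded_measurable (f : T -> R) :=
  measurable_fun [set: T] f /\ exists M, forall x, `|f x| <= M.

Lemma bounded_measurable_cst a : bounded_measurable (cst a).
Proof. by split; [exact: measurable_cst|exists `|a|]. Qed.

Lemma bounded_measurableD f g : bounded_measurable f -> bounded_measurable g ->
  bounded_measurable (fun x => f x + g x).
Proof.
move=> [mf [M fM]] [mg [N gN]]; split; first exact: measurable_funD.
by exists (M + N) => x; rewrite (le_trans (ler_normD _ _)) // lerD.
Qed.

Lemma bounded_measurableN f : bounded_measurable f ->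
  bounded_measurable (fun x => - f x).
Proof.
move=> [mf [M fM]]; split; first exact: measurable_funN.
by exists M => x; rewrite normrN.
Qed.

Lemma bounded_measurableM f g : bounded_measurable f -> bounded_measurable g ->
  bounded_measurable (fun x => f x * g x).
Proof.
move=> [mf [M fM]] [mg [N gN]]; split; first exact: measurable_funM.
by exists (M * N) => x; rewrite normrM ler_pM.
Qed.

Definition cbounded_measurable (f : T -> R[i]) :=
  bounded_measurable (fun x => Re (f x)) /\ bounded_measurable (fun x => Im (f x)).

Lemma cbounded_measurable_cst a : cbounded_measurable (cst a).
Proof. by split; exact: bounded_measurable_cst. Qed.

Lemma cbounded_measurableD f g : cbounded_measurable f -> cbounded_measurable g ->
  cbounded_measurable (fun x => f x + g x).
Proof.
move=> [f1 f2] [g1 g2]; split.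
  rewrite (_ : (fun _ => _) = fun x => Re (f x) + Re (g x)).
    exact: bounded_measurableD.
  by apply/funext => x /=; case: (f x); case: (g x).
rewrite (_ : (fun _ => _) = fun x => Im (f x) + Im (g x)).
  exact: bounded_measurableD.
by apply/funext => x /=; case: (f x); case: (g x).
Qed.

Lemma cbounded_measurableM f g : cbounded_measurable f -> cbounded_measurable g ->
  cbounded_measurable (fun x => f x * g x).
Proof.
move=> [f1 f2] [g1 g2]; split.
  rewrite (_ : (fun _ => _) = fun x => Re (f x) * Re (g x) + - (Im (f x) * Im (g x))).
    apply: bounded_measurableD; first exact: bounded_measurableM.
    by apply: bounded_measurableN; exact: bounded_measurableM.
  by apply/funext => x /=; case: (f x); case: (g x).
rewrite (_ : (fun _ => _) = fun x => Re (f x) * Im (g x) + Im (f x) * Re (g x)).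
  by apply: bounded_measurableD; exact: bounded_measurableM.
by apply/funext => x /=; case: (f x); case: (g x).
Qed.

Lemma cbounded_measurable_sum (I : Type) (s : seq I) (f : I -> T -> R[i]) :
  (forall i, cbounded_measurable (f i)) ->
  cbounded_measurable (fun x => \sum_(i <- s) f i x).
Proof.
move=> mf; elim: s => [|i s IH].
  rewrite (_ : (fun _ => _) = cst 0); first exact: cbounded_measurable_cst.
  by apply/funext => x; rewrite big_nil.
rewrite (_ : (fun _ => _) = fun x => f i x + \sum_(j <- s) f j x).
  exact: cbounded_measurableD.
by apply/funext => x; rewrite big_cons.
Qed.

Lemma cbounded_measurable_prod (I : Type) (s : seq I) (f : I -> T -> R[i]) :
  (forall i, cbounded_measurable (f i)) ->
  cbounded_measurable (fun x => \prod_(i <- s) f i x).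
Proof.
move=> mf; elim: s => [|i s IH].
  rewrite (_ : (fun _ => _) = cst 1); first exact: cbounded_measurable_cst.
  by apply/funext => x; rewrite big_nil.
rewrite (_ : (fun _ => _) = fun x => f i x * \prod_(j <- s) f j x).
  exact: cbounded_measurableM.
by apply/funext => x; rewrite big_cons.
Qed.

Lemma bounded_measurable_integrable (P : probability T R) f :
  bounded_measurable f -> P.-integrable [set: T] (EFin \o f).
Proof.
move=> [mf [M fM]]; apply: measurable_bounded_integrable => //.
  exact: le_lt_trans (probability_le1 P measurableT) (ltry _).
exists M; split; first exact: num_real.
by move=> N MN x _; exact: le_trans (fM x) (ltW MN).
Qed.

Section Expectation.
Variable P : probability T R.

Lemma complex_expectationD f g : cbounded_measurable f -> cbounded_measurable g ->
  complex_expectation P (fun x => f x + g x) =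
  complex_expectation P f + complex_expectation P g.
Proof.
move=> [f1 f2] [g1 g2]; rewrite /complex_expectation.
have -> : (fun x => Re (f x + g x)) = fun x => Re (f x) + Re (g x).
  by apply/funext => x; case: (f x); case: (g x).
have -> : (fun x => Im (f x + g x)) = fun x => Im (f x) + Im (g x).
  by apply/funext => x; case: (f x); case: (g x).
by rewrite !RintegralD //; exact: bounded_measurable_integrable.
Qed.

Lemma complex_expectation0 : complex_expectation P (fun=> 0) = 0.
Proof. by rewrite /complex_expectation /= Rintegral_cst // mul0r. Qed.

Lemma complex_expectation_sum (I : Type) (s : seq I) (f : I -> T -> R[i]) :
  (forall i, cbounded_measurable (f i)) ->
  complex_expectation P (fun x => \sum_(i <- s) f i x) =
  \sum_(i <- s) complex_expectation P (f i).
Proof.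
move=> mf; elim: s => [|i s IH].
  rewrite big_nil -[RHS]complex_expectation0; congr complex_expectation.
  by apply/funext => x; rewrite big_nil.
rewrite big_cons -IH -complex_expectationD //; last exact: cbounded_measurable_sum.
by congr complex_expectation; apply/funext => x; rewrite big_cons.
Qed.

Lemma complex_expectationZ a f : cbounded_measurable f ->
  complex_expectation P (fun x => a * f x) = a * complex_expectation P f.
Proof.
move=> [f1 f2]; have i1 := bounded_measurable_integrable P f1.
have i2 := bounded_measurable_integrable P f2.
have iZ b g : bounded_measurable g ->
    P.-integrable [set: T] (EFin \o (fun x => b * g x)).
  move=> mg; apply: bounded_measurable_integrable.
  exact: bounded_measurableM (bounded_measurable_cst b) mg.
rewrite /complex_expectation; case: a => a b.
have -> : (fun x => Re (Complex a b * f x)) = fun x => a * Re (f x) + - b * Im (f x).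
  by apply/funext => x; case: (f x) => u v /=; rewrite mulNr.
have -> : (fun x => Im (Complex a b * f x)) = fun x => a * Im (f x) + b * Re (f x).
  by apply/funext => x; case: (f x).
rewrite !RintegralD ?RintegralZl //; try exact: iZ.
by congr Complex; rewrite /= mulNr.
Qed.

Lemma norm_complex_expectation_le f (M : R) (A : set T) :
  measurable A -> cbounded_measurable f ->
  (forall x, `|Re (f x)| <= M * \1_A x) -> (forall x, `|Im (f x)| <= M * \1_A x) ->
  `|complex_expectation P f| <= (2 * M * fine (P A))%:C%C.
Proof.
move=> mA [f1 f2] Re_le Im_le.
have MA : bounded_measurable (fun x => M * \1_A x).
  apply: bounded_measurableM; first exact: bounded_measurable_cst.
  split; first exact: measurable_indic.
  by exists 1 => x; rewrite indicE; case: (_ \in _); rewrite ?normr1 ?normr0 ?ler01.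
have bound g : bounded_measurable g -> (forall x, `|g x| <= M * \1_A x) ->
    `|(\int[P]_x g x)%R| <= M * fine (P A).
  move=> mg gM; have ig := bounded_measurable_integrable P mg.
  apply: (le_trans (le_normr_Rintegral _ ig)) => //.
  apply: (@le_trans _ _ (\int[P]_x (M * \1_A x))%R).
    apply: le_Rintegral => //; first exact: integrable_norm.
    exact: bounded_measurable_integrable.
  rewrite RintegralZl //; last first.
    apply: bounded_measurable_integrable; split; first exact: measurable_indic.
    by exists 1 => x; rewrite indicE; case: (_ \in _);
      rewrite ?normr1 ?normr0 ?ler01.
  by rewrite /Rintegral integral_indic // setIT.
apply: (le_trans (normc_le_ReD_Im _)); rewrite lecR.
by rewrite -mulrA mulr_natl mulr2n lerD ?bound.
Qed.
End Expectation.
End BoundedMeasurable.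

Section BorelSpaces.
Variable R : realType.

Lemma continuous_borel (K L : topologicalGroupType) (f : K -> L) :
  continuous f -> measurable_fun [set: borel K] (f : borel K -> borel L).
Proof.
move=> cf; apply: (@measurability _ _ (borel K) (borel L) setT f (@open L)) => //.
move=> _ [U oU <-].
rewrite setTI; apply: sub_sigma_algebra.
by apply: open_comp => // x _; exact: cf.
Qed.

Lemma continuous_borel_real (K : topologicalGroupType) (f : K -> R) :
  continuous f -> measurable_fun [set: borel K] (f : borel K -> R).
Proof.
move=> cf; apply: (measurability _ (RGenOpens.measurableE R)) => // _ [_ [a [b ->]] <-].
rewrite setTI; apply: sub_sigma_algebra.
by apply: open_comp => [x _|]; [exact: cf|exact: interval_open].
Qed.

Lemma Re_continuous : continuous (@complex.Re R : (R[i])^o -> R).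
Proof.
move=> z A /nbhs_ballP[e /= e0 eA]; apply/nbhs_ballP.
exists (e%:C)%C; first by rewrite /= ltcR.
move=> y; rewrite /ball /= => zy; apply: eA; rewrite /ball /= -ltcR.
by apply: le_lt_trans zy; rewrite -raddfB; exact: normc_ge_Re.
Qed.

Lemma Im_continuous : continuous (@complex.Im R : (R[i])^o -> R).
Proof.
move=> z A /nbhs_ballP[e /= e0 eA]; apply/nbhs_ballP.
exists (e%:C)%C; first by rewrite /= ltcR.
move=> y; rewrite /ball /= => zy; apply: eA; rewrite /ball /= -ltcR.
by apply: le_lt_trans zy; rewrite -raddfB; exact: normc_ge_Im.
Qed.

End BorelSpaces.

(** These sets generate the sigma-algebra on which independence determines the
joint law of the generators. It may be smaller than the Borel one, but the
matrix entries of a word are measurable for it, being polynomials in continuous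
functions of one coordinate each. *)
Definition rectangles (K : topologicalGroupType) (r : nat) : set_system ('I_r -> K) :=
  [set B | exists A : 'I_r -> set (borel K),
    (forall i, measurable (A i)) /\ B = [set k | forall i, A i (k i)]].

Notation tuples K r := (g_sigma_algebraType (@rectangles K r)).

Section Coordinates.
Variable R : realType.

Lemma coordinate_measurable (K : topologicalGroupType) (r : nat) (i : 'I_r) :
  measurable_fun [set: tuples K r] (fun k : tuples K r => k i : borel K).
Proof.
move=> _ A mA; rewrite setTI; apply: sub_sigma_algebra.
exists (fun j => if j == i then A else setT); split.
  by move=> j; case: ifP => // _; exact: measurableT.
apply/seteqP; split=> k /=; last by move/(_ i); rewrite eqxx.
by move=> Aki j; case: eqP => [->|].
Qed.

Lemma continuous_coordinate_cbm (K : topologicalGroupType) (r : nat) (i : 'I_r)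
    (f : K -> (R[i])^o) (M : R) :
  continuous f -> (forall x, `|f x| <= (M%:C)%C) ->
  cbounded_measurable (fun k : tuples K r => f (k i)).
Proof.
move=> cf fM; have lift_meas (g : K -> R) : continuous g ->
    measurable_fun [set: tuples K r] (fun k : tuples K r => g (k i)).
  move=> cg; apply: (@measurableT_comp _ _ _ _ _ _ (g : borel K -> R)).
    exact: continuous_borel_real.
  exact: coordinate_measurable.
split; split.
- apply: (lift_meas (fun x => complex.Re (f x))) => x.
  by apply: continuous_comp; [exact: cf|exact: Re_continuous].
- exists M => k /=; rewrite -lecR; apply: le_trans (fM _).
  exact: normc_ge_Re.
- apply: (lift_meas (fun x => complex.Im (f x))) => x.
  by apply: continuous_comp; [exact: cf|exact: Im_continuous].
- exists M => k /=; rewrite -lecR; apply: le_trans (fM (k i)).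
  exact: normc_ge_Im.
Qed.
End Coordinates.

(** * Invariance under translations of the generators *)

Section HaarShift.
Variables (R : realType) (r : nat) (K : topologicalGroupType).
Variables (d : measure_display) (Omega : measurableType d) (P : probability Omega R).
Variable alpha : Omega -> freegroup 'I_r -> K.
Hypothesis alpha_haar : haar_random_hom P alpha.

Definition generator_tuple (om : Omega) : tuples K r :=
  fun i => alpha om (freegroup_gen i).

Definition shift_tuple (t : 'I_r -> K) (k : tuples K r) : tuples K r :=
  fun i => (t i * k i)%g.

Lemma generator_tuple_measurable : measurable_fun [set: Omega] generator_tuple.
Proof.
case: alpha_haar => _ mX _ _.
apply: (@measurability _ _ Omega (tuples K r) setT _ (@rectangles K r)) => //.
move=> _ [_ [A [mA ->]] <-].
rewrite (_ : _ `&` _ = \big[setI/setT]_(i < r)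
    ((fun om => alpha om (freegroup_gen i) : borel K) @^-1` A i)).
  by apply: bigsetI_measurable => i _; rewrite -[X in measurable X]setTI; exact: mX.
rewrite -bigcap_seq setTI; apply/seteqP; split=> om /= omA i.
  by move=> _; exact: omA.
by apply: omA; rewrite /= mem_index_enum.
Qed.

Lemma left_mul_continuous (g : K) : continuous (fun x : K => g * x)%g.
Proof.
move=> x; apply: (cvg_comp2 _ _ (@mulg_continuous K (g, x))).
  exact: cvg_cst.
exact: cvg_id.
Qed.

Lemma shift_tuple_measurable t : measurable_fun [set: tuples K r] (shift_tuple t).
Proof.
apply: (@measurability _ _ (tuples K r) (tuples K r) setT _ (@rectangles K r)) => //.
move=> _ [_ [A [mA ->]] <-]; rewrite setTI; apply: sub_sigma_algebra.
exists (fun i => (fun x : borel K => (t i * x)%g : borel K) @^-1` A i); split=> // i.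
by rewrite -[X in measurable X]setTI; 
    exact: (continuous_borel (@left_mul_continuous (t i)) measurableT (mA i)).
Qed.

Lemma haar_rectangle : exists2 mu : probability (borel K) R, haar_probability mu &
  forall A : 'I_r -> set (borel K), (forall i, measurable (A i)) ->
  P (generator_tuple @^-1` [set k | forall i, A i (k i)]) = (\prod_(i < r) mu (A i))%E.
Proof.
case: alpha_haar => _ _ [mu mu_haar mu_law] ind; exists mu => // A mA.
rewrite (_ : _ @^-1` _ = \bigcap_i
    ((fun om => alpha om (freegroup_gen i) : borel K) @^-1` A i)).
  by rewrite ind //; apply: eq_bigr => i _; exact: mu_law.
by apply/seteqP; split=> om /= omA i; [move=> _|]; exact: omA.
Qed.

Lemma haar_rectangle_shift (t : 'I_r -> K) (A : 'I_r -> set (borel K)) :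
  (forall i, measurable (A i)) ->
  P (generator_tuple @^-1` (shift_tuple t @^-1` [set k | forall i, A i (k i)])) =
  P (generator_tuple @^-1` [set k | forall i, A i (k i)]).
Proof.
move=> mA; have [mu [mu_inv _] rect] := haar_rectangle.
pose tA i := (fun x : borel K => (t i * x)%g : borel K) @^-1` A i.
have mtA i : measurable (tA i).
  by rewrite -[X in measurable X]setTI; 
    exact: (continuous_borel (@left_mul_continuous (t i)) measurableT (mA i)).
rewrite (rect A) // -[X in P (_ @^-1` X)]/[set k : tuples K r | forall i, tA i (k i)].
rewrite rect //; apply: eq_bigr => i _; rewrite -(mu_inv (t i)) //.
congr (mu _); apply/seteqP; split=> x /=; first by case=> y tAy <-.
by move=> Ax; exists ((t i)^-1 * x)%g; rewrite /tA /= mulgA mulgV mul1g.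
Qed.

(** The rectangles are stable under intersection, so the two laws that agree on
them have the same integrals. *)
Lemma haar_shift_integral (t : 'I_r -> K) (f : tuples K r -> R) :
  bounded_measurable f ->
  (\int[P]_om f (shift_tuple t (generator_tuple om)))%R =
  (\int[P]_om f (generator_tuple om))%R.
Proof.
move=> [mf [M fM]].
pose X1 : {mfun Omega >-> tuples K r} := mfun_Sub (mem_set generator_tuple_measurable).
have mX2 : measurable_fun [set: Omega] (shift_tuple t \o generator_tuple).
  apply: measurableT_comp; first exact: shift_tuple_measurable.
  exact: generator_tuple_measurable.
pose X2 : {mfun Omega >-> tuples K r} := mfun_Sub (mem_set mX2).
have lawE : forall A : set (tuples K r), measurable A ->
    distribution P X2 A = distribution P X1 A.
  move=> A mA; apply: (@measure_unique _ R (tuples K r) (@rectangles K r)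
    (fun=> setT) _ _ _ _ (distribution P X2) (distribution P X1)) => // {A mA}.
  - move=> _ _ [A [mA ->]] [B [mB ->]]; exists (fun i => A i `&` B i); split.
      by move=> i; exact: measurableI.
    apply/seteqP; split=> k /=; first by move=> [kA kB] i; split.
    by move=> kAB; split=> i; have [] := kAB i.
  - move=> _; exists (fun=> setT); split=> //; apply/seteqP; split=> //.
  - by apply/seteqP; split=> // k _; exists 0%N.
  - by move=> _ [A [mA ->]]; exact: haar_rectangle_shift.
  - move=> _; exact: le_lt_trans (probability_le1 _ measurableT) (ltry _).
have mEf : measurable_fun [set: tuples K r] (EFin \o f) by exact/measurable_EFinP.
have int_f (X : {mfun Omega >-> tuples K r}) :
    P.-integrable [set: Omega] ((EFin \o f) \o X).
  apply: (@bounded_measurable_integrable _ _ _ P (f \o X)); split.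
    exact: measurableT_comp.
  by exists M => om; exact: fM.
rewrite /Rintegral; congr fine.
have := integral_distribution mEf (int_f X1).
have := integral_distribution mEf (int_f X2).
rewrite (eq_measure_integral (distribution P X1)) => [->|A mA _]; last exact: lawE.
by [].
Qed.

Lemma haar_shift_expectation (t : 'I_r -> K) (f : tuples K r -> R[i]) :
  cbounded_measurable f ->
  complex_expectation P (fun om => f (shift_tuple t (generator_tuple om))) =
  complex_expectation P (fun om => f (generator_tuple om)).
Proof.
move=> [f1 f2]; rewrite /complex_expectation.
by rewrite (haar_shift_integral t f1) (haar_shift_integral t f2).
Qed.

Lemma cbounded_measurable_generator (f : tuples K r -> R[i]) :
  cbounded_measurable f ->
  cbounded_measurable (fun om => f (generator_tuple om)).
Proof.
have comp (g : tuples K r -> R) : bounded_measurable g ->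
    bounded_measurable (fun om => g (generator_tuple om)).
  move=> [mg [M gM]]; split; last by exists M => om; exact: gM.
  exact: (measurableT_comp mg generator_tuple_measurable).
move=> [f1 f2]; split; first exact: (comp (fun k => complex.Re (f k)) f1).
exact: (comp (fun k => complex.Im (f k)) f2).
Qed.

End HaarShift.

(** * Closed paths in the wreath product *)

Section WreathPaths.
Variables (G : topologicalGroupType) (S : finGroupType) (X : finType).
Variables (to : {action S &-> X}) (r l : nat) (c : 'I_l -> 'I_r * bool).
Local Notation wr := (wreath G to).

Definition path_event (x : 'I_l -> X) (k : 'I_r -> wr) :=
  [forall j, to (x (edge_src c j)) ((k (c j).1).2 : S) == x (edge_tgt c j)].

(** Along a path that follows the letters, this is the entry of the monomial
matrix of the letter [c j] in the row of [x j] ([path_event_step]). *)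
Definition path_step (x : 'I_l -> X) (k : 'I_r -> wr) j : G :=
  let v := (k (c j).1).1 (x (edge_src c j)) in if (c j).2 then v else (v^-1)%g.

Definition path_value (x : 'I_l -> X) (k : 'I_r -> wr) : G :=
  (\prod_(j < l) path_step x k j)%g.

(** The images of the generators at the ends of oriented edges, against the images
of the letters in the order of the word. *)
Lemma path_eventP x (k : 'I_r -> wr) : reflect
  (forall j, to (x j) ((letter_val k (c j) : wr).2 : S) = x (ordS j)) (path_event x k).
Proof.
apply: (iffP forallP) => h j; have := h j; rewrite /edge_src /edge_tgt /letter_val.
  by case: (c j).2 => /eqP // <-; rewrite /= actK.
by case: (c j).2 => [->//|/= <-]; rewrite actKV.
Qed.

Lemma path_event_step x (k : 'I_r -> wr) j : path_event x k ->
  (letter_val k (c j) : wr).1 (x j) = path_step x k j.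
Proof.
move=> /path_eventP/(_ j); rewrite /path_step /edge_src /letter_val.
by case: (c j).2 => //= <-.
Qed.

Lemma wreath_prod_fst (h : nat -> wr) m x :
  ((\prod_(0 <= i < m) h i)%g : wr).1 x =
  (\prod_(0 <= i < m) (h i).1 (to x (((\prod_(0 <= p < i) h p)%g : wr).2 : S)))%g.
Proof.
elim: m => [|m IH]; first by rewrite !big_nil.
by rewrite !big_nat_recr //= IH.
Qed.

(** A fixed point of the product starts exactly one path that follows the
letters. *)
Lemma induced_char_paths (R : realType) (phi : G -> R[i]) (k : 'I_r -> wr) :
  (0 < l)%N ->
  induced_char phi (\prod_(j < l) letter_val k (c j))%g =
  \sum_(x : l.-tuple X) (path_event (tnth x) k)%:R * phi (path_value (tnth x) k).
Proof.
move=> l0; pose j0 := Ordinal l0.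
(* Indexing the letters by all natural numbers makes the partial products
available. *)
pose h m : wr := if insub m is Some j then letter_val k (c j) else 1%g.
have hE (j : 'I_l) : h j = letter_val k (c j) by rewrite /h valK.
have prodE m : (m <= l)%N ->
    (\prod_(0 <= i < m) h i = \prod_(j < l | (j < m)%N) letter_val k (c j))%g.
  move=> ml; rewrite big_mkord (big_ord_widen _ h ml).
  by apply: eq_bigr => j _; rewrite hE.
have -> : (\prod_(j < l) letter_val k (c j) = \prod_(0 <= i < l) h i)%g.
  by rewrite prodE //; apply: eq_bigl => j; rewrite ltn_ord.
pose y x m := to x (((\prod_(0 <= i < m) h i)%g : wr).2 : S).
have yS x m : y x m.+1 = to (y x m) ((h m).2 : S).
  by rewrite /y big_nat_recr //= actM.
have y0 x : y x 0%N = x by rewrite /y big_nil act1.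
pose path x : l.-tuple X := [tuple y x j | j < l].
have pathE x j : tnth (path x) j = y x j by rewrite tnth_mktuple.
have ordSE (j : 'I_l) : (j.+1 < l)%N /\ ordS j = j.+1 :> nat \/
    j.+1 = l /\ ordS j = j0.
  have [jl|lj] := ltnP j.+1 l; [left|right]; first by rewrite /= modn_small.
  have jl : j.+1 = l by apply/eqP; rewrite eqn_leq lj ltn_ord.
  by split=> //; apply: val_inj; rewrite /= jl modnn.
have eventE x : path_event (tnth (path x)) k = (y x l == x).
  apply/path_eventP/eqP => [ev|yl j].
    have := ev (Ordinal (eq_leq (prednK l0))); set j := Ordinal _.
    rewrite !pathE -hE -yS.
    case: (ordSE j) => -[jl ->]; first by rewrite /= prednK // ltnn in jl.
    by rewrite /= prednK // y0.
  rewrite !pathE -hE -yS; case: (ordSE j) => -[jl ->] //.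
  by rewrite jl y0.
have pathK (x : l.-tuple X) : path_event (tnth x) k -> path (tnth x j0) = x.
  move=> /path_eventP ev; apply: eq_from_tnth => j; rewrite pathE.
  case: j; elim=> [|m IH] ml; first by rewrite y0; congr tnth; exact: val_inj.
  have m_l := ltn_trans (ltnSn m) ml.
  rewrite yS -[m in h m]/(val (Ordinal m_l)) hE [y _ _](IH m_l) ev.
  by congr tnth; apply: val_inj; rewrite /= modn_small.
rewrite (eq_bigr (fun x : l.-tuple X =>
    if path_event (tnth x) k then phi (path_value (tnth x) k) else 0)); last first.
  by move=> x _; case: path_event; rewrite ?mul1r ?mul0r.
rewrite -big_mkcond /= (reindex_onto path (fun x => tnth x j0)) //.
rewrite /induced_char; apply: eq_big => x.
  by rewrite eventE pathE y0 eqxx andbT.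
move=> yl; congr phi; rewrite wreath_prod_fst big_mkord /path_value.
apply: eq_bigr => j _; rewrite -path_event_step ?eventE // pathE.
by rewrite hE.
Qed.
End WreathPaths.

(** * The law of the permutation part *)

Section WreathHaar.
Variables (R : realType) (G : topologicalGroupType) (S : finGroupType) (X : finType).
Variables (to : {action S &-> X}).
Local Notation wr := (wreath G to).

Lemma wreath_snd_open (B : {set S}) : open [set k : wr | (k.2 : S) \in B].
Proof.
rewrite openE => k /= kB; have := @wreath_snd_near G S X to k.
by rewrite /interior; apply: filterS => h /= ->.
Qed.

Lemma wreath_snd_measurable (B : {set S}) :
  measurable ([set k : wr | (k.2 : S) \in B] : set (borel wr)).
Proof. by apply: sub_sigma_algebra; exact: wreath_snd_open. Qed.

(** The fibres of the projection to [S] are translates of each other. *)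
Lemma haar_snd (mu : probability (borel wr) R) (B : {set S}) : haar_probability mu ->
  mu [set k : wr | (k.2 : S) \in B] = (#|B|%:R / #|[set: S]%SET|%:R)%:E.
Proof.
move=> [mu_inv _].
pose p := fine (mu [set k : wr | (k.2 : S) \in [set 1%g]%SET]).
have p1 s : mu [set k : wr | (k.2 : S) \in [set s]%SET] = p%:E.
  rewrite /p fineK; last by rewrite fin_num_measure //; exact: wreath_snd_measurable.
  rewrite -(mu_inv ((fun=> 1%g, s) : wr) [set k : wr | (k.2 : S) \in [set 1%g]%SET]);
    last exact: wreath_snd_measurable.
  congr (mu _); apply/seteqP; split=> k /=.
    rewrite finset.in_set1 => /eqP ks; exists ((fun x => k.1 (to x s^-1%g)), 1%g) => /=.
      by rewrite finset.in_set1.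
    case: k ks => v s' /= ->; congr pair; last by rewrite /= mulg1.
    by apply/funext => x; rewrite /= mul1g actK.
  case=> k'; rewrite !finset.in_set1 => /eqP k'1 <- /=.
  by rewrite k'1 mulg1.
have pB (C : {set S}) : mu [set k : wr | (k.2 : S) \in C] = (#|C|%:R * p)%:E.
  have [n] := ubnP #|C|; elim: n C => // n IH C Cn.
  have [->|[s sC]] := set_0Vmem C.
    rewrite cards0 mul0r -[X in mu X](_ : set0 = _) ?measure0 //.
    by apply/seteqP; split=> k //=; rewrite finset.in_set0.
  have cC := cardsD1 s C; rewrite sC in cC.
  rewrite (_ : [set k : wr | _] = [set k : wr | (k.2 : S) \in [set s]%SET] `|`
      [set k : wr | (k.2 : S) \in (C :\ s)%SET]); last first.
    apply/seteqP; split=> k /=; rewrite !inE.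
      by move=> kC; case: eqP => [|]; [left|right].
    by case=> [/eqP -> //|/andP[]].
  transitivity (mu [set k : wr | (k.2 : S) \in [set s]%SET] +
      mu [set k : wr | (k.2 : S) \in (C :\ s)%SET])%E.
    apply: measureU; try exact: wreath_snd_measurable.
    by apply/seteqP; split=> k //= -[]; rewrite !inE => ->.
  rewrite p1 IH; last by move: Cn; rewrite cC.
  by rewrite cC -EFinD natrD mulrDl mul1r.
have S0 : (#|[set: S]%SET|%:R : R) != 0 by rewrite pnatr_eq0 -lt0n cardG_gt0.
have := pB [set: S]%SET; rewrite (_ : [set k : wr | _] = setT); last first.
  by apply/seteqP; split=> k //= _; rewrite finset.in_setT.
rewrite probability_setT => -[p_inv].
rewrite pB; congr EFin; congr (_ * _).
by rewrite -[p](mulKf S0) -p_inv mulr1.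
Qed.
End WreathHaar.

(** * Expectations along closed paths *)

Lemma compact_continuous_bounded (R : realType) (G : topologicalGroupType)
    (f : G -> (R[i])^o) : compact [set: G] -> continuous f ->
  exists M : R, forall g, `|f g| <= (M%:C)%C.
Proof.
move=> cG cf; have real_bound (h : G -> R) : continuous h ->
    exists M, forall g, `|h g| <= M.
  move=> ch; have := @continuous_compact _ _ h _ (continuous_subspaceT ch) cG.
  move=> /compact_bounded[M [_ hM]]; exists (M + 1) => g.
  by apply: hM; [rewrite ltrDl|exists g].
have [M1 fM1] : exists M, forall g, `|complex.Re (f g)| <= M.
  apply: real_bound => g.
  by apply: continuous_comp; [exact: cf|exact: Re_continuous].
have [M2 fM2] : exists M, forall g, `|complex.Im (f g)| <= M.
  apply: real_bound => g.
  by apply: continuous_comp; [exact: cf|exact: Im_continuous].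
exists (M1 + M2) => g; apply: le_trans (normc_le_ReD_Im _) _.
by rewrite lecR lerD.
Qed.

Section PathExpectation.
Variables (R : realType) (G : topologicalGroupType) (S : finGroupType) (X : finType).
Variables (to : {action S &-> X}) (dim : nat) (rho : G -> 'M[R[i]]_dim).
Variables (r l : nat) (c : 'I_l -> 'I_r * bool).
Local Notation wr := (wreath G to).
Local Notation C := R[i].
Local Notation T := (tuples wr r).

Hypothesis G_compact : compact [set: G].
Hypothesis rho_cont : continuous_repr rho.

Let rhoM g h : rho (g * h)%g = rho g *m rho h. Proof. by case: rho_cont. Qed.

Lemma repr_entry_continuous a b : continuous (fun g => rho g a b : C^o).
Proof. by case: rho_cont => _ _ /mx_continuous_coord. Qed.

Lemma trace_bounded : exists M : R, forall g, `|\tr (rho g)| <= (M%:C)%C.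
Proof.
have /choice[M rhoMb] a : exists M : R, forall g, `|rho g a a| <= (M%:C)%C.
  by apply: (compact_continuous_bounded G_compact); exact: repr_entry_continuous.
exists (\sum_a M a) => g; rewrite (le_trans (ler_norm_sum _ _ _)) //.
by rewrite raddf_sum ler_sum.
Qed.

Lemma path_step_entry_cbm x j a b :
  cbounded_measurable (fun k : T => rho (path_step c x k j) a b).
Proof.
have [M rhoMb] := compact_continuous_bounded G_compact (@repr_entry_continuous a b).
pose f (h : wr) : C^o := let v := h.1 (x (edge_src c j)) in
  rho (if (c j).2 then v else v^-1%g) a b.
apply: (@continuous_coordinate_cbm _ _ _ (c j).1 f M); last by move=> h; exact: rhoMb.
have fst_cont := @wreath_fst_continuous G S X to (x (edge_src c j)).
rewrite /f; case: (c j).2 => h.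
  apply: (@continuous_comp _ _ _ (fun h : wr => h.1 (x (edge_src c j)) : G)
    (fun g => rho g a b : C^o)); first exact: fst_cont.
  exact: repr_entry_continuous.
apply: (@continuous_comp _ _ _ (fun h : wr => (h.1 (x (edge_src c j)))^-1%g : G)
  (fun g => rho g a b : C^o)); last exact: repr_entry_continuous.
apply: (@continuous_comp _ _ _ (fun h : wr => h.1 (x (edge_src c j)) : G)
  (fun g => g^-1%g)); first exact: fst_cont.
exact: invg_continuous.
Qed.

Lemma path_word_entry_cbm x (s : seq 'I_l) a b :
  cbounded_measurable
    (fun k : T => rho (\prod_(j <- s) path_step c x k j)%g a b).
Proof.
elim: s a b => [|j s IH] a b.
  rewrite (_ : (fun _ => _) = cst (rho 1%g a b)).
    exact: cbounded_measurable_cst.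
  by apply/funext => k; rewrite big_nil.
rewrite (_ : (fun _ => _) = fun k : T =>
    \sum_e rho (path_step c x k j) a e * rho (\prod_(j <- s) path_step c x k j)%g e b).
  apply: cbounded_measurable_sum => e; apply: cbounded_measurableM => //.
  exact: path_step_entry_cbm.
by apply/funext => k; rewrite big_cons rhoM mxE.
Qed.

(** The event concerns only the permutations, which are locally constant. *)
Lemma path_event_cbm x :
  cbounded_measurable (fun k : T => (path_event c x k)%:R : C).
Proof.
pose f j (h : wr) : C^o := (to (x (edge_src c j)) (h.2 : S) == x (edge_tgt c j))%:R.
rewrite (_ : (fun _ => _) = fun k : T => \prod_(j < l) (f j (k (c j).1) : C)).
  apply: cbounded_measurable_prod => j.
  apply: (@continuous_coordinate_cbm _ _ _ (c j).1 (f j) 1).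
    move=> h A /nbhs_singleton Ah; have := @wreath_snd_near G S X to h.
    by apply: filterS => h' h'h; rewrite /= /f h'h.
  by move=> h; rewrite /f normr_nat rmorph1 lern1; case: eqP.
apply/funext => k; have [/forallP ev|] := boolP (path_event c x k).
  by rewrite big1 // => j _; rewrite /f (eqP (ev j)) eqxx.
rewrite negb_forall => /existsP[j nj].
by rewrite (bigD1 j) //= /f (negPf nj) mul0r.
Qed.

Variables (d : measure_display) (Omega : measurableType d) (P : probability Omega R).
Variable alpha : Omega -> freegroup 'I_r -> wr.
Hypothesis alpha_haar : haar_random_hom P alpha.
Local Notation gen := (generator_tuple alpha).

Lemma path_event_movers x (k : 'I_r -> wr) :
  path_event c x k <-> forall i, ((k i).2 : S) \in movers to c x i.
Proof.
split=> [/forallP ev i|mov].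
  by apply/moversP => j <-; exact/eqP.
by apply/forallP => j; apply/eqP; have /moversP := mov (c j).1; exact.
Qed.

Lemma path_event_probability x :
  measurable (gen @^-1` [set k | path_event c x k]) /\
  fine (P (gen @^-1` [set k | path_event c x k])) =
  \prod_i (#|movers to c x i|%:R / #|[set: S]%SET|%:R).
Proof.
have -> : [set k | path_event c x k] = [set k : 'I_r -> wr |
    forall i, [set h : wr | (h.2 : S) \in movers to c x i] (k i)].
  by apply/seteqP; split=> k /=; rewrite path_event_movers.
have mA i : measurable ([set h : wr | (h.2 : S) \in movers to c x i] : set (borel wr)).
  exact: wreath_snd_measurable.
split.
  rewrite -[X in measurable X]setTI.
  apply: (generator_tuple_measurable alpha_haar) => //.
  by apply: sub_sigma_algebra; eexists; split; first exact: mA.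
have [mu mu_haar rect] := haar_rectangle alpha_haar.
rewrite (_ : P _ = (\prod_(i < r)
    (#|movers to c x i|%:R / #|[set: S]%SET|%:R : R)%:E)%E); first by rewrite prodEFin.
rewrite -(eq_bigr _ (fun i _ => haar_snd (movers to c x i) mu_haar)).
exact: rect mA.
Qed.

(** The factor [2] accounts for the real and the imaginary part. *)
Lemma path_expectation_le x (M : R) : (forall g, `|\tr (rho g)| <= (M%:C)%C) ->
  `|complex_expectation P
      (fun om => (path_event c x (gen om))%:R * \tr (rho (path_value c x (gen om))))|
  <= ((2 * M * \prod_i (#|movers to c x i|%:R / #|[set: S]%SET|%:R))%:C)%C.
Proof.
move=> trM; have [mA <-] := path_event_probability x.
have part_le (f : C -> R) om : f 0 = 0 -> (forall z, (`|f z|%:C)%C <= `|z|) ->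
    `|f ((path_event c x (gen om))%:R * \tr (rho (path_value c x (gen om))))| <=
    M * \1_(gen @^-1` [set k | path_event c x k]) om.
  move=> f0 f_le; rewrite indicE; case: (boolP (path_event c x (gen om))) => ev.
    rewrite mem_set // mul1r mulr1 -lecR.
    exact: le_trans (f_le _) (trM _).
  by rewrite memNset ?mul0r ?f0 ?normr0 ?mulr0 //=; exact/negP.
apply: norm_complex_expectation_le => //.
- apply: (cbounded_measurable_generator alpha_haar
    (f := fun k : T => (path_event c x k)%:R * \tr (rho (path_value c x k)))).
  apply: cbounded_measurableM; first exact: path_event_cbm.
  by apply: cbounded_measurable_sum => a; exact: path_word_entry_cbm.
- by move=> om; apply: part_le => // z; exact: normc_ge_Re.
- by move=> om; apply: part_le => // z; exact: normc_ge_Im.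
Qed.

Hypothesis rho_irr : irreducible_repr rho.
Hypothesis rho_nontriv : (fun g => \tr (rho g)) <> (fun=> 1).
Hypothesis c_red : cyclically_reduced c.

Section Injective.
Variables (x : 'I_l -> X) (j0 : 'I_l).
Hypothesis x_inj : injective x.

(** Left translation by [h] of the entry read at position [j0]: by injectivity of
[x] no other position reads the entry that changes. *)
Let shift (h : G) : 'I_r -> wr := fun i =>
  if i == (c j0).1 then at_site to (x (edge_src c j0)) h else 1%g.

Lemma path_event_shift h k :
  path_event c x (shift_tuple (shift h) k) = path_event c x k.
Proof.
apply: eq_forallb => j; rewrite /shift_tuple /shift.
by case: ifP => _; rewrite ?mul1g // wreath_mulE /= mul1g.
Qed.

Lemma path_step_shift h k j :
  path_step c x (shift_tuple (shift h) k) j =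
  if j == j0 then
    (if (c j0).2 then h * path_step c x k j0 else path_step c x k j0 * h^-1)%g
  else path_step c x k j.
Proof.
rewrite /path_step /shift_tuple /shift.
have [->|jj0] := eqVneq j j0.
  rewrite eqxx wreath_mulE /= eqxx act1; case: (c j0).2 => //.
  by rewrite invMg.
have [ij|ij] := eqVneq (c j).1 (c j0).1; last by rewrite mul1g.
rewrite wreath_mulE /= act1.
case: eqP => [/x_inj sj|_]; last by rewrite mul1g.
by case/eqP: jj0; exact: (edge_src_inj c_red).
Qed.

(** The expected matrix of the product along the path, with the letters taken in
the order given by [s]. *)
Let entry_mx (s : seq 'I_l) : 'M[C]_dim := \matrix_(a, b)
  complex_expectation P (fun om => (path_event c x (gen om))%:R *
    rho (\prod_(j <- s) path_step c x (gen om) j)%g a b).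

Let summand s a b (k : T) : C :=
  (path_event c x k)%:R * rho (\prod_(j <- s) path_step c x k j)%g a b.

Let summand_cbm s a b : cbounded_measurable (summand s a b).
Proof.
by apply: cbounded_measurableM; [exact: path_event_cbm|exact: path_word_entry_cbm].
Qed.

Let summand_gen_cbm s a b : cbounded_measurable (fun om => summand s a b (gen om)).
Proof. exact: (cbounded_measurable_generator alpha_haar). Qed.

Lemma tail_shift h k s : j0 \notin s ->
  (\prod_(j <- s) path_step c x (shift_tuple (shift h) k) j =
   \prod_(j <- s) path_step c x k j)%g.
Proof.
move=> j0s; rewrite !big_seq; apply: eq_bigr => j js; rewrite path_step_shift.
by case: eqP => // jE; rewrite -jE js in j0s.
Qed.

(** The translation by [h] multiplies the random matrix by [rho h] on the left
without changing its expectation. *)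
Lemma entry_mx_head s : j0 \notin s -> (c j0).2 -> entry_mx (j0 :: s) = 0.
Proof.
move=> j0s cj0; apply: (mx_fixed_eq0 rho_irr rho_nontriv) => h.
apply/matrixP => a b; rewrite !mxE.
rewrite -(haar_shift_expectation alpha_haar (shift h) (summand_cbm (j0 :: s) a b)).
transitivity (complex_expectation P (fun om =>
    \sum_e rho h a e * summand (j0 :: s) e b (gen om))).
  rewrite complex_expectation_sum => [|e]; last first.
    by apply: cbounded_measurableM; [exact: cbounded_measurable_cst|exact: summand_gen_cbm].
  by apply: eq_bigr => e _; rewrite mxE complex_expectationZ //; exact: summand_gen_cbm.
congr complex_expectation; apply/funext => om; rewrite /summand path_event_shift.
rewrite [in RHS]big_cons tail_shift // path_step_shift eqxx cj0 -mulgA.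
rewrite [in RHS]rhoM mxE mulr_sumr; apply: eq_bigr => e _.
by rewrite mulrCA big_cons.
Qed.

(** An inverse letter is multiplied on its right instead, so it is read last and
the rows of the expectation are fixed. *)
Lemma entry_mx_last s : j0 \notin s -> ~~ (c j0).2 -> entry_mx (rcons s j0) = 0.
Proof.
move=> j0s cj0; apply/row_matrixP => a0; rewrite row0.
apply: (row_fixed_eq0 rho_irr rho_nontriv) => h; rewrite -row_mul; congr row.
apply/matrixP => a b; rewrite !mxE.
rewrite -(haar_shift_expectation alpha_haar (shift h^-1%g) (summand_cbm (rcons s j0) a b)).
transitivity (complex_expectation P (fun om =>
    \sum_e rho h e b * summand (rcons s j0) a e (gen om))).
  rewrite complex_expectation_sum => [|e]; last first.
    by apply: cbounded_measurableM; [exact: cbounded_measurable_cst|exact: summand_gen_cbm].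
  apply: eq_bigr => e _; rewrite mxE [LHS]mulrC complex_expectationZ //.
congr complex_expectation; apply/funext => om; rewrite /summand path_event_shift.
rewrite [in RHS]big_rcons /= tail_shift // path_step_shift eqxx (negPf cj0) invgK mulgA.
rewrite [in RHS]rhoM mxE mulr_sumr; apply: eq_bigr => e _.
by rewrite big_rcons /= mulrC mulrA.
Qed.

Lemma path_word_expectation0 s :
  (forall k : T, \tr (rho (path_value c x k)) =
    \tr (rho (\prod_(j <- s) path_step c x k j)%g)) -> entry_mx s = 0 ->
  complex_expectation P
    (fun om => (path_event c x (gen om))%:R * \tr (rho (path_value c x (gen om)))) = 0.
Proof.
move=> sE s0.
transitivity (complex_expectation P (fun om => \sum_a summand s a a (gen om))).
  congr complex_expectation; apply/funext => om.
  by rewrite sE /mxtrace mulr_sumr.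
rewrite complex_expectation_sum; last by move=> a; exact: summand_gen_cbm.
by rewrite big1 // => a _; move/matrixP: s0 => /(_ a a); rewrite !mxE.
Qed.

(** The trace allows the first letter to be read last. *)
Lemma injective_path_expectation_from s : index_enum 'I_l = j0 :: s ->
  complex_expectation P
    (fun om => (path_event c x (gen om))%:R * \tr (rho (path_value c x (gen om)))) = 0.
Proof.
move=> enumE; have /andP[j0s _] : uniq (j0 :: s).
  by rewrite -enumE; exact: index_enum_uniq.
have [cj0|cj0] := boolP (c j0).2.
  apply: (@path_word_expectation0 (j0 :: s)); last exact: entry_mx_head.
  by move=> k; rewrite /path_value enumE.
apply: (@path_word_expectation0 (rcons s j0)); last exact: entry_mx_last.
move=> k; rewrite /path_value enumE big_cons big_rcons /= !rhoM.
exact: mxtrace_mulC.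
Qed.
End Injective.

Lemma injective_path_expectation x : (0 < l)%N -> injective x ->
  complex_expectation P
    (fun om => (path_event c x (gen om))%:R * \tr (rho (path_value c x (gen om)))) = 0.
Proof.
move=> l0 x_inj; case enumE: (index_enum 'I_l) => [|j0 s].
  by have := mem_index_enum (Ordinal l0); rewrite enumE.
exact: (injective_path_expectation_from x_inj enumE).
Qed.

Hypothesis to_trans : [transitive [set: S]%SET, on [set: X]%SET | to].
Hypothesis c_aper : aperiodic c.

(** The triangle inequality over the paths, of which only the non-injective ones
contribute. *)
Lemma word_expectation_le (M : R) : (0 < l)%N ->
  (forall g, `|\tr (rho g)| <= (M%:C)%C) ->
  `|complex_expectation P (fun om => induced_char (fun g => \tr (rho g))
      (\prod_(j < l) letter_val (gen om : 'I_r -> wr) (c j))%g)| <=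
  ((2 * M * (#|orbit (to * l)%act [set: S]%SET @: [set: l.-tuple X]%SET|%:R
     / #|X|%:R))%:C)%C.
Proof.
move=> l0 trM.
have M0 : 0 <= M by rewrite -lecR; apply: le_trans (trM 1%g); exact: normr_ge0.
pose F (x : l.-tuple X) om : C := (path_event c (tnth x) (gen om))%:R *
  \tr (rho (path_value c (tnth x) (gen om))).
have F_cbm x : cbounded_measurable (F x).
  apply: (cbounded_measurable_generator alpha_haar (f := fun k : T =>
    (path_event c (tnth x) k)%:R * \tr (rho (path_value c (tnth x) k)))).
  apply: cbounded_measurableM; first exact: path_event_cbm.
  by apply: cbounded_measurable_sum => a; exact: path_word_entry_cbm.
rewrite (_ : (fun _ => _) = fun om => \sum_(x : l.-tuple X) F x om); last first.
  by apply/funext => om; rewrite induced_char_paths.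
rewrite complex_expectation_sum // (le_trans (ler_norm_sum _ _ _)) //.
apply: (@le_trans _ _ (\sum_(x : l.-tuple X | ~~ injectiveb (tnth x))
    ((2 * M * \prod_i (#|movers to c (tnth x) i|%:R / #|[set: S]%SET|%:R))%:C)%C)).
  rewrite [leRHS]big_mkcond /=; apply: ler_sum => x _.
  have [/injectiveP x_inj|_] := boolP (injectiveb (tnth x)); last first.
    exact: path_expectation_le.
  by rewrite /F injective_path_expectation // normr0.
rewrite -raddf_sum lecR -mulr_sumr ler_wpM2l ?mulr_ge0 //.
exact: sum_noninjective_movers.
Qed.
End PathExpectation.

(** * The bound on word measures *)

Lemma induced_char_conj (R : realType) (G : topologicalGroupType) (S : finGroupType)
    (X : finType) (to : {action S &-> X}) (d : nat) (rho : G -> 'M[R[i]]_d)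
    (F : groupType) (alpha : F -> wreath G to) (v u : F) :
  continuous_repr rho -> monoid.monoid_morphism alpha ->
  induced_char (fun g => \tr (rho g)) (alpha (v ^ u)%g) =
  induced_char (fun g => \tr (rho g)) (alpha v).
Proof.
move=> rho_cont [_ alphaM]; have [_ indM _] := induced_continuous_repr to rho_cont.
rewrite -!induced_trace conjgE alphaM indM mxtrace_mulC -indM -alphaM.
by rewrite -mulgA mulgV mulg1.
Qed.

Theorem theoremA5 (R : realType)
    (G : topologicalGroupType)
    (G_compact : compact [set: G]) (G_hausdorff : hausdorff_space G)
    (dim_phi : nat) (phi : G -> R[i])
    (phi_irr : irreducible_character dim_phi phi)
    (phi_nontrivial : phi <> (fun=> 1))
    (S : nat -> finGroupType) (X : nat -> finType)
    (to : forall n, {action S n &-> X n})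
    (to_trans : forall n, [transitive [set: S n]%SET, on [set: X n]%SET | to n])
    (to_olig : asymptotically_oligomorphic to)
    (r : nat) (w : freegroup 'I_r)
    (w_not_power : ~ proper_power w) :
  (forall n, irreducible_character (#|X n| * dim_phi)%N
               (induced_char phi : wreath G (to n) -> R[i])) /\
  exists C : R, forall (n : nat)
    (d : measure_display) (Omega : measurableType d) (P : probability Omega R)
    (alpha : Omega -> freegroup 'I_r -> wreath G (to n)),
    haar_random_hom P alpha ->
    `|word_expectation P alpha w (induced_char phi)|
      <= (C * (#|X n| * dim_phi)%:R `^ (- 2^-1))%:C%C.
Proof.
split=> [n|]; first exact: induced_char_irreducible.
have [rho [rho_cont rho_irr phiE]] := phi_irr.
have phi_tr : phi = fun g => \tr (rho g) by apply/funext.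
have [l [c [u [l0 wE c_red c_aper]]]] := exists_aperiodic_conjugate w_not_power.
have [B orbits_le] := to_olig l.
have [M trM] := trace_bounded G_compact rho_cont.
have M0 : 0 <= M by rewrite -lecR; apply: le_trans (trM 1%g); exact: normr_ge0.
exists (2 * M * B%:R * dim_phi%:R) => n d Omega P alpha alpha_haar.
have alpha_mor om : monoid.monoid_morphism (alpha om) by case: alpha_haar.
rewrite /word_expectation phi_tr.
rewrite (_ : (fun _ => _) = fun om => induced_char (fun g => \tr (rho g))
    (\prod_(j < l) letter_val (generator_tuple alpha om : 'I_r -> wreath G (to n))
      (tnth c j))%g); last first.
  apply/funext => om; rewrite wE (induced_char_conj _ _ rho_cont (alpha_mor om)).
  have /= -> := monoid_morphism_prod c (alpha_mor om).
  by rewrite big_tuple.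
rewrite phi_tr in phi_nontrivial.
have := word_expectation_le G_compact rho_cont alpha_haar rho_irr
  phi_nontrivial c_red (to_trans n) c_aper l0 trM.
move=> /le_trans; apply.
have dim_gt0 : (0 < dim_phi)%N by case: rho_irr.
have X_gt0 : (0 < #|X n|)%N.
  by have /imsetP[x _ _] := to_trans n; apply/card_gt0P; exists x.
have dim0 : (dim_phi%:R : R) != 0 by rewrite pnatr_eq0 -lt0n.
have Nd_ge1 : (1 : R) <= (#|X n| * dim_phi)%:R by rewrite ler1n muln_gt0 X_gt0.
rewrite lecR -!mulrA !ler_wpM2l //.
apply: (@le_trans _ _ (B%:R * (#|X n|%:R)^-1)).
  by rewrite ler_wpM2r ?invr_ge0 // ler_nat orbits_le.
rewrite ler_wpM2l // -[leLHS](mulKf dim0) mulrCA ler_wpM2l //.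
rewrite -invfM mulrC -natrM.
(* The paths give a bound by a multiple of the inverse of the dimension, and the
dimension is at least [1]. *)
have half_le1 : (- 1 : R) <= - 2^-1 by rewrite lerN2 invf_le1 ?ler1n.
by have := ler_powR Nd_ge1 half_le1; rewrite powR_inv1 ?ler0n.
Qed.
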